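(* Let $n\ge 2$ and let $B=B(x_0,R)$ be an open ball in $\mathbb{R}^n$. Let $\psi\in C_0^\infty(\mathbb{R}^n)$ satisfy $\operatorname{supp}\psi\subseteq B$ and $\int_{\mathbb{R}^n}\psi=1$. Let $\Omega\subset\mathbb{R}^n$ be a bounded open set which is star-shaped with respect to every point of $\overline{B}$. Then for every $F\in C_D(\Omega)$ with $\int_\Omega F=0$, the formula $$v(x)=\int_\Omega F(y)\left[\frac{x-y}{|x-y|^n}\int_{|x-y|}^{+\infty}\psi\Big(y+\xi\frac{x-y}{|x-y|}\Big)\xi^{n-1}\,d\xi\right]dy,\qquad x\in\mathbb{R}^n,$$ defines a function $v\in C^1(\Omega)\cap C^0(\mathbb{R}^n)$ satisfying $\operatorname{div} v(x)=F(x)$ for all $x\in\Omega$ and $v\equiv 0$ on $\mathbb{R}^n\setminus\Omega$.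
   Context: $\Omega$ is star-shaped with respect to a point $p$ if $p\in\Omega$ and for every $y\in\Omega$ the segment joining $p$ and $y$ lies in $\Omega$. For a function $F$ on $\Omega$, $\omega(F,\rho)=\sup_{x,y\in\Omega,\ |x-y|<\rho}|F(x)-F(y)|$; $C_D(\Omega)$ is the space of functions $F$ on $\Omega$ such that $\omega(F,\rho)/\rho$ is integrable near $0^+$ (uniformly Dini-continuous functions). *)

(* Defs.v *)
From HB Require Import structures.
From mathcomp Require Import all_boot all_order all_algebra.
From mathcomp Require Import all_classical all_reals all_analysis.
Set Implicit Arguments. Unset Strict Implicit. Unset Printing Implicit Defensive.
Import Order.TTheory GRing.Theory Num.Def Num.Theory.
Import numFieldNormedType.Exports.
Local Open Scope classical_set_scope.
Local Open Scope ring_scope.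

Section Defs.
Variable R : realType.

Definition enorm n (x : 'rV[R]_n) : R := Num.sqrt (\sum_(i < n) (x 0 i) ^+ 2).

Definition ebase n (i : 'I_n) : 'rV[R]_n := delta_mx 0 i.

Definition eball n (x0 : 'rV[R]_n) (r : R) : set 'rV[R]_n :=
  [set x | enorm (x - x0) < r].

Definition rcons_row m (t : R) (y : 'rV[R]_m) : 'rV[R]_m.+1 :=
  \row_(i < m.+1) (if unlift ord0 i is Some j then y 0 j else t).

(* Integral over R^n of a nonnegative extended-real function, as the iterated
   one-dimensional Lebesgue integral (equal to the n-dimensional Lebesgue
   integral by Tonelli's theorem). *)
Fixpoint nnint (n : nat) : ('rV[R]_n -> \bar R) -> \bar R :=
  match n return ('rV[R]_n -> \bar R) -> \bar R with
  | 0 => fun g => g 0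
  | m.+1 => fun g =>
      (\int[lebesgue_measure]_(t in [set: R]) nnint (fun y => g (rcons_row t y)))%E
  end.

Definition Rn_integrable n (f : 'rV[R]_n -> R) : Prop :=
  (nnint (fun x => (`|f x|)%:E) < +oo)%E.

Definition Rn_integral n (f : 'rV[R]_n -> R) : R :=
  fine (nnint (fun x => (Num.max (f x) 0)%:E))
  - fine (nnint (fun x => (Num.max (- f x) 0)%:E)).

Fixpoint iterD n (s : seq 'I_n) (f : 'rV[R]_n -> R) : 'rV[R]_n -> R :=
  match s with
  | [::] => f
  | i :: s' => fun x => 'D_(ebase i) (iterD s' f) x
  end.

Definition smooth n (f : 'rV[R]_n -> R) : Prop :=
  forall s : seq 'I_n, continuous (iterD s f) /\
    forall (i : 'I_n) (x : 'rV[R]_n), derivable (iterD s f) x (ebase i).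

Definition fsupp n (f : 'rV[R]_n -> R) : set 'rV[R]_n :=
  closure [set x | f x != 0].

Definition C0inf n (f : 'rV[R]_n -> R) : Prop :=
  smooth f /\ compact (fsupp f).

Definition star_shaped n (Om : set 'rV[R]_n) (p : 'rV[R]_n) : Prop :=
  Om p /\ forall y, Om y -> forall t : R, 0 <= t <= 1 -> Om ((1 - t) *: p + t *: y).

Definition ebounded n (Om : set 'rV[R]_n) : Prop :=
  exists M : R, forall x, Om x -> enorm x <= M.

Definition modcont n (Om : set 'rV[R]_n) (F : 'rV[R]_n -> R) (rho : R) : \bar R :=
  ereal_sup [set e | exists x y, [/\ Om x, Om y, enorm (x - y) < rho
                                     & e = (`|F x - F y|)%:E]].

Definition C_D n (Om : set 'rV[R]_n) (F : 'rV[R]_n -> R) : Prop :=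
  exists delta : R, 0 < delta /\
    (\int[lebesgue_measure]_(rho in (`]0%R, delta]%classic : set R)) (modcont Om F rho * (rho^-1)%:E)
       < +oo)%E.

Definition divergence n (v : 'rV[R]_n -> 'rV[R]_n) (x : 'rV[R]_n) : R :=
  \sum_(i < n) ('D_(ebase i) v x) 0 i.

Definition C1_on n (Om : set 'rV[R]_n) (v : 'rV[R]_n -> 'rV[R]_n) : Prop :=
  forall i : 'I_n, forall x, Om x ->
    derivable v x (ebase i) /\ {for x, continuous (fun z => 'D_(ebase i) v z)}.

Definition kernel_integrand n (Om : set 'rV[R]_n) (F psi : 'rV[R]_n -> R)
    (x : 'rV[R]_n) (i : 'I_n) (y : 'rV[R]_n) : R :=
  (y \in Om)%:R * F y *
  ((x - y) 0 i / enorm (x - y) ^+ n *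
   \int[lebesgue_measure]_(xi in (`[enorm (x - y), +oo[%classic : set R))
       (psi (y + xi *: ((enorm (x - y))^-1 *: (x - y))) * xi ^+ n.-1)).

Definition bogovskii n (Om : set 'rV[R]_n) (F psi : 'rV[R]_n -> R)
    (x : 'rV[R]_n) : 'rV[R]_n :=
  \row_(i < n) Rn_integral (kernel_integrand Om F psi x i).

End Defs.

(* Main.v *)
(** Put [E = 1_Om F] and [P_t(x, y) = y + (x - y) / t].  The substitution
[xi = |x - y| / t] turns the formula into
[v_i(x) = \int_0^1 g_i(t, x) dt] with
[g_i(t, x) = t^-(n+1) \int E(y) (x - y)_i psi(P_t(x, y)) dy],
where each [g_i(t, .)] is continuously differentiable and [g_i] is bounded.
When [E] is replaced by a constant, [\int_y] becomes explicit through the affine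
change of variables [z = P_t(x, y)], and the [x]-derivative of [g_i] is then
[O(1)] instead of [O(1/t)].  Subtracting the constant [E(x)] therefore gives
[|D_j g_i(t, x)| <= W w(t) / t + O(1)] for small [t], [w] being the modulus of
continuity of [F]; the Dini condition makes this integrable in [t], and dominated
convergence yields [v] of class C1.
For the divergence, [\sum_i D_i g_i = - A'(t)] with
[A(t) = t^-n \int E(y) psi(P_t(x, y)) dy], where [A(1) = psi(x) \int E = 0] and
[A(t) --> E(x)] as [t --> 0].
If [x] is outside [Om], no segment from a point of [Om] to the support of [psi]
contains [x], so the kernel vanishes identically. *)
Require Import Defs.
From HB Require Import structures.
From mathcomp Require Import all_boot all_order all_algebra.
From mathcomp Require Import all_classical all_reals all_analysis.
From mathcomp Require Import measurable_realfun.
From mathcomp Require Import ring lra.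
Import Order.TTheory GRing.Theory Num.Def Num.Theory.
Import numFieldNormedType.Exports.
Local Open Scope classical_set_scope.
Local Open Scope ring_scope.

Set Implicit Arguments.
Unset Strict Implicit.
Unset Printing Implicit Defensive.

(** * Lebesgue measure on row vectors *)

(** The difficulty is at [t = 0]. The change of variables [z = P_t(x, y)] has Jacobian
    [(t / (1 - t))^n], and [x - y = t / (1 - t) (P_t - x)] with [P_t] in the support of [psi];
    together they compensate [t^-(n+1)] exactly, so [g_i] is bounded while [D_j g_i] keeps one
    factor [1/t]. For the constant density [1], [g_i] is exactly [(1 - t)^-(n+1) (m_i - x_i)], [m_i]
    being the first moments of [psi], so its derivative has no [1/t]. Both computations degenerate
    at [t = 1], where [P_t] no longer depends on [y]; away from [0] crude bounds from the bounded
    support of [E] are used instead. Chaining along segments serves twice. It bounds [F], since the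
    Dini condition only gives a scale at which the modulus is below [1]; and it trades the modulus
    at distance [2 t (Z + r)], which the kernel sees, for a multiple of [w(t)], which the hypothesis
    controls. Integrals in the statement are iterated, so a measure with the same integrals is built
    first to have Fubini and dominated convergence. On rows [|x|] is the sup norm; [enorm] comes
    from the definitions and is compared with it up to the factor [n]. *)

Section borel_row.
Context (R : realType) (n : nat).

Definition borel_row : set (set 'rV[R]_n) := <<s open >>.

Lemma borel_row0 : borel_row set0.
Proof. exact: sigma_algebra0. Qed.

Lemma borel_rowC A : borel_row A -> borel_row (~` A).
Proof. exact: sigma_algebraC. Qed.

Lemma borel_row_bigcup (F : (set 'rV[R]_n)^nat) :
  (forall i, borel_row (F i)) -> borel_row (\bigcup_i (F i)).
Proof. exact: sigma_algebra_bigcup. Qed.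

End borel_row.

HB.instance Definition _ (R : realType) (n : nat) :=
  @isMeasurable.Build default_measure_display 'rV[R]_n
    (@borel_row R n) (@borel_row0 R n) (@borel_rowC R n) (@borel_row_bigcup R n).

Section measurable_row.
Context {R : realType}.
Implicit Types n : nat.

Lemma open_measurable_row n (U : set 'rV[R]_n) : open U -> measurable U.
Proof. by move=> oU; exact: sub_sigma_algebra. Qed.

Lemma continuous_measurable_row n (f : 'rV[R]_n -> R) :
  continuous f -> measurable_fun setT f.
Proof.
move=> cf; apply: (measurability (@RGenOpens.G R)) => [|/=].
  exact: RGenOpens.measurableE.
move=> _ [_ [a [b ->] <-]]; rewrite setTI; apply: open_measurable_row.
by apply: open_comp => // x _; exact: cf.
Qed.

Lemma coord_measurable n (i : 'I_n) :
  measurable_fun setT (fun x : 'rV[R]_n => x 0 i).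
Proof. by apply: continuous_measurable_row => x; exact: coord_continuous. Qed.

(** Boxes with rational centre and size are countably many. This is what lets [measurable_rowP] test
    measurability into ['rV[R]_n] coordinate by coordinate. *)
Lemma open_row_bigcup n (U : set 'rV[R]_n) : open U ->
  U = \bigcup_(p in [set p : 'rV[rat]_n * rat |
        [set x : 'rV[R]_n | forall i, `|x 0 i - ratr (p.1 0 i)| < ratr p.2]
          `<=` U])
      [set x | forall i, `|x 0 i - ratr (p.1 0 i)| < ratr p.2].
Proof.
move=> oU; apply/seteqP; split => [x Ux|x [p /= pU px]]; last exact: pU.
have /nbhs_ballP[e /= e0 eU] : nbhs x U by exact: open_nbhs_nbhs.
(* A box of half-width [q / 2] whose centre is within [q / 2] of [x] contains [x] and stays within
   [q < e] of it. *)
have [q /andP[]] := rat_in_itvoo e0; rewrite !bnd_simp => q0 qe.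
have q20 : (0 : R) < ratr q / 2 by rewrite divr_gt0.
have xx i : x 0 i - ratr q / 2 < x 0 i + ratr q / 2 by lra.
have /choice[c /all_and2[c1 c2]] : forall i : 'I_n, exists c : rat,
    x 0 i - ratr q / 2 < ratr c /\ ratr c < x 0 i + ratr q / 2.
  move=> i; have [c /andP[]] := rat_in_itvoo (xx i).
  by rewrite !bnd_simp => ? ?; exists c.
exists (\row_i c i, q / 2) => /=.
  move=> y yc; apply: eU; split => // i j; rewrite (ord1 i) {i} /ball /=.
  have := yc j; rewrite mxE fmorph_div /= ratr_nat !ltr_norml => /andP[h1 h2].
  have h3 := c1 j; have h4 := c2 j.
  by apply/andP; split; lra.
move=> i; rewrite mxE fmorph_div /= ratr_nat ltr_norml.
have h3 := c1 i; have h4 := c2 i.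
by apply/andP; split; lra.
Qed.

Lemma measurable_row_box n (c : 'I_n -> R) (q : R) :
  measurable [set x : 'rV[R]_n | forall i, `|x 0 i - c i| < q].
Proof.
rewrite (_ : [set _ | _] = \bigcap_(i in [set: 'I_n])
   ((fun x : 'rV[R]_n => x 0 i) @^-1` `](c i - q), (c i + q)[)); last first.
  apply/seteqP; split => x /= h i => [_|]; have := h i; rewrite /= in_itv /= ltr_distl//.
  exact.
apply: fin_bigcap_measurable => // i _.
by rewrite -[X in measurable X]setTI; exact: coord_measurable.
Qed.

Lemma measurable_rowP d (T : measurableType d) n (f : T -> 'rV[R]_n) :
  (forall i, measurable_fun setT (fun t => f t 0 i)) -> measurable_fun setT f.
Proof.
move=> mf; apply: (measurability (@open 'rV[R]_n)) => //.
move=> _ [U oU <-]; rewrite setTI (open_row_bigcup oU) preimage_bigcup.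
rewrite bigcup_mkcond; apply: countable_bigcupT_measurable => // p.
case: ifP => // _.
rewrite (_ : _ @^-1` _ = \bigcap_(i in [set: 'I_n])
   ((fun t => f t 0 i) @^-1`
     `](ratr (p.1 0 i) - ratr p.2), (ratr (p.1 0 i) + ratr p.2)[)); last first.
  by apply/seteqP; split => x /= h i => [_|]; have := h i;
    rewrite /= in_itv /= ltr_distl//; exact.
apply: fin_bigcap_measurable => // i _.
by rewrite -[X in measurable X]setTI; exact: mf.
Qed.

Lemma rcons_row0 n t (y : 'rV[R]_n) : rcons_row t y 0 ord0 = t.
Proof. by rewrite mxE unlift_none. Qed.

Lemma rcons_rowS n t (y : 'rV[R]_n) j : rcons_row t y 0 (lift ord0 j) = y 0 j.
Proof. by rewrite mxE liftK. Qed.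

Lemma measurable_rcons_row n :
  measurable_fun setT
    (fun p : measurableTypeR R * 'rV[R]_n => rcons_row p.1 p.2).
Proof.
apply: measurable_rowP => i.
case: (unliftP ord0 i) => [j ->|->].
  apply: (eq_measurable_fun (fun p : measurableTypeR R * 'rV[R]_n => p.2 0 j)).
    by move=> p _; rewrite rcons_rowS.
  exact: (measurableT_comp (coord_measurable j) measurable_snd).
apply: (eq_measurable_fun (fun p : measurableTypeR R * 'rV[R]_n => p.1)).
  by move=> p _; rewrite rcons_row0.
exact: measurable_fst.
Qed.

Lemma row0E (x : 'rV[R]_0) : x = 0.
Proof. by apply/rowP => -[]. Qed.

Definition cube n (q : R) : set 'rV[R]_n := [set x | forall i, `|x 0 i| < q].

Lemma measurable_cube n q : measurable (@cube n q).
Proof.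
have := @measurable_row_box n (fun=> 0) q.
by under eq_set do under eq_forall do rewrite subr0.
Qed.

End measurable_row.

Section rvmeas_step.
Context {R : realType} (n : nat).
Variable mu : {sigma_finite_measure set 'rV[R]_n -> \bar R}.

(** Pushing the product measure along [rcons_row] mirrors one recursion step of [nnint], so that the
    comparison of the two integrals is Tonelli at each step. *)
Definition rvmeasS : set 'rV[R]_n.+1 -> \bar R :=
  pushforward (lebesgue_measure \x mu)%E
    (fun p : measurableTypeR R * 'rV[R]_n => rcons_row p.1 p.2).

Lemma rvmeasS0 : rvmeasS set0 = 0%E.
Proof. by rewrite /rvmeasS /pushforward preimage_set0 measure0. Qed.

Lemma rvmeasS_ge0 A : (0 <= rvmeasS A)%E.
Proof.
have mf := @measurable_rcons_row R n.
exact: measure_ge0.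
Qed.

Lemma rvmeasS_sigma_additive : semi_sigma_additive rvmeasS.
Proof.
have mf := @measurable_rcons_row R n.
exact: measure_semi_sigma_additive.
Qed.

HB.instance Definition _ := isMeasure.Build _ _ _ rvmeasS
  rvmeasS0 rvmeasS_ge0 rvmeasS_sigma_additive.

Lemma rvmeasS_cube (q : R) :
  (mu (@cube R n q) < +oo)%E -> (rvmeasS (@cube R n.+1 q) < +oo)%E.
Proof.
move=> fq; rewrite /rvmeasS /pushforward.
rewrite (_ : _ @^-1` _ = `](- q), q[ `*` @cube R n q); last first.
  apply/seteqP; split => -[t y] /=.
    move=> h; split.
      by have := h ord0; rewrite rcons_row0 in_itv /= ltr_norml.
    by move=> i; have := h (lift ord0 i); rewrite rcons_rowS.
  move=> [h1 h2] i; case: (unliftP ord0 i) => [j ->|->].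
    by rewrite rcons_rowS.
  by rewrite rcons_row0 ltr_norml; rewrite in_itv in h1.
rewrite product_measure1E//; last exact: measurable_cube.
apply: lte_mul_pinfty => //.
rewrite ge0_fin_numE//.
change (lebesgue_measure (`](- q)%R, q%R[%classic : set R) < +oo)%E.
by rewrite lebesgue_measure_itv /= lte_fin; case: ifPn => _; rewrite -?EFinD ltry.
Qed.

End rvmeas_step.

Definition cube_finite {R : realType} n (mu : set 'rV[R]_n -> \bar R) :=
  forall q, (mu (@cube R n q) < +oo)%E.

Lemma bigcup_cube {R : realType} n : \bigcup_k (@cube R n k%:R) = setT.
Proof.
apply/seteqP; split => // x _.
exists (Num.bound (\sum_(i < n) `|x 0 i|)) => // i /=.
apply: le_lt_trans (archi_boundP _); last exact: sumr_ge0.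
by rewrite (bigD1 i) //= lerDl sumr_ge0.
Qed.

Lemma cube_finite_sigma_finite {R : realType} n (mu : set 'rV[R]_n -> \bar R) :
  cube_finite mu -> sigma_finite setT mu.
Proof.
move=> fmu; exists (fun k => @cube R n k%:R); first by rewrite bigcup_cube.
by move=> k; split; [exact: measurable_cube|exact: fmu].
Qed.

(* Finiteness on cubes is carried along the recursion because it is what makes
   the next product measure sigma-finite. *)
Definition radon_row {R : realType} n :=
  {mu : {sigma_finite_measure set 'rV[R]_n -> \bar R} | cube_finite mu}.

(** The Dirac mass turns evaluation at [0], the base case of [nnint], into an integral. The proof is
    transparent so that [rvmeas 0] reduces to it in [nnintE]. *)
Definition radon_row0 {R : realType} : @radon_row R 0.
Proof.
exists [the {sigma_finite_measure set 'rV[R]_0 -> \bar R} of \d_(0 : 'rV[R]_0)].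
by move=> q; rewrite /= diracE; case: (_ \in _) => /=; rewrite ltry.
Defined.

Lemma rvmeasS_cube_finite {R : realType} n (mu : @radon_row R n) :
  cube_finite (rvmeasS (sval mu)).
Proof. by move=> q; apply: rvmeasS_cube; exact: (svalP mu). Qed.

Definition radon_rowS {R : realType} n (mu : @radon_row R n) :
    @radon_row R n.+1 :=
  exist (fun nu : {sigma_finite_measure set 'rV[R]_n.+1 -> \bar R} => cube_finite nu)
    (HB.pack_for {sigma_finite_measure set 'rV[R]_n.+1 -> \bar R}
      (rvmeasS (sval mu))
      (Measure_isSigmaFinite.Build _ _ _ _
        (cube_finite_sigma_finite (rvmeasS_cube_finite mu))))
    (rvmeasS_cube_finite mu).

Fixpoint radon_row_rec {R : realType} n : @radon_row R n :=
  match n with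
  | 0 => radon_row0
  | m.+1 => radon_rowS (radon_row_rec m)
  end.

Definition rvmeas {R : realType} n := sval (@radon_row_rec R n).

Section nnint.
Context {R : realType}.
Local Open Scope ereal_scope.

Lemma integral_rvmeasS n (g : 'rV[R]_n.+1 -> \bar R) :
  measurable_fun setT g -> (forall x, 0 <= g x) ->
  \int[rvmeas n.+1]_x g x =
  \int[lebesgue_measure]_t \int[rvmeas n]_y g (rcons_row t y).
Proof.
move=> mg g0.
have mr := @measurable_rcons_row R n.
transitivity (\int[pushforward (lebesgue_measure \x (@rvmeas R n))
    (fun p : measurableTypeR R * 'rV[R]_n => rcons_row p.1 p.2)]_x g x); first reflexivity.
rewrite ge0_integral_pushforward//= preimage_setT.
rewrite fubini_tonelli1//.
exact: (measurableT_comp mg mr).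
Qed.

Lemma nnintE n (g : 'rV[R]_n -> \bar R) :
  measurable_fun setT g -> (forall x, 0 <= g x) ->
  nnint g = \int[rvmeas n]_x g x.
Proof.
elim: n g => [g mg g0|n IH g mg g0].
  transitivity (\int[\d_(0%R : 'rV[R]_0)]_x g x); last reflexivity.
  by rewrite integral_dirac//= diracT mul1e.
rewrite integral_rvmeasS//=; apply: eq_integral => t _.
rewrite IH//.
apply: (measurableT_comp mg).
exact: (measurableT_comp (@measurable_rcons_row R n) (measurable_pair1 t)).
Qed.

End nnint.

Section image_measure.
Context d1 d2 (T1 : measurableType d1) (T2 : measurableType d2) (R : realType).
Variables (m : {measure set T1 -> \bar R}) (f : T1 -> T2).
Hypothesis mf : measurable_fun setT f.

Definition image_measure : {measure set T2 -> \bar R}.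
Proof.
refine [the {measure set T2 -> \bar R} of pushforward m f].
exact: mf.
Defined.

End image_measure.

(** * Affine changes of variables, in one and in several dimensions *)

Section affine_change_of_variables.
Context {R : realType}.
Local Open Scope ereal_scope.
Notation leb := (@lebesgue_measure R).

Lemma lebesgue_measure_affine (a b : R) (A : set (measurableTypeR R)) :
  (a != 0)%R -> measurable A ->
  `|a|%:E * leb ((fun t => a * t + b)%R @^-1` A) = leb A.
Proof.
move=> a0 mA.
have ap : (0 < `|a|)%R by rewrite normr_gt0.
have mf : measurable_fun setT (fun t : measurableTypeR R => a * t + b : measurableTypeR R)%R.
  by apply: measurable_funD => //; exact: mulrl_measurable.
pose m := image_measure leb mf.
(* Lebesgue measure is determined by its values on the intervals []u, v]], so the scaled image
   measure needs checking only there. For negative [a] the preimage is closed on the left instead,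
   with the same length. *)
transitivity (mscale (NngNum (ltW ap)) m A) => //.
apply/esym/lebesgue_measure_unique => // X [[u v] _ <-].
transitivity (`|a|%:E * leb ((fun t => a * t + b)%R @^-1` `]u, v])); last reflexivity.
have [an|an] := ltrP 0%R a.
  rewrite (_ : _ @^-1` _ = `]((u - b) / a)%R, ((v - b) / a)%R]%classic); last first.
    apply/seteqP; split => x /=; rewrite !in_itv /= ltr_pdivrMr// ler_pdivlMr//;
      by rewrite ltrBlDr lerBrDr mulrC.
  rewrite !lebesgue_measure_itv /= !lte_fin ltr_pM2r ?invr_gt0// ltrD2r.
  case: ifPn => _; last by rewrite mule0.
  rewrite -!EFinB -EFinM; congr EFin.
  by rewrite gtr0_norm//; field.
have {}an : (a < 0)%R by rewrite lt_neqAle a0.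
rewrite (_ : _ @^-1` _ = `[((v - b) / a)%R, ((u - b) / a)%R[%classic); last first.
  apply/seteqP; split => x /=; rewrite !in_itv /= ltr_ndivlMr// ler_ndivrMr//;
    by rewrite ltrBlDr lerBrDr mulrC andbC.
rewrite !lebesgue_measure_itv /= !lte_fin ltr_nM2r ?invr_lt0// ltrD2r.
case: ifPn => _; last by rewrite mule0.
rewrite -!EFinB -EFinM; congr EFin.
by rewrite ltr0_norm//; field.
Qed.

Lemma ge0_integral_affine1 (a b : R) (f : measurableTypeR R -> \bar R) :
  (a != 0)%R -> measurable_fun setT f -> (forall t, 0 <= f t) ->
  \int[leb]_t f (a * t + b)%R = (`|a|^-1)%:E * \int[leb]_t f t.
Proof.
move=> a0 mfun f0.
have ap : (0 < `|a|)%R by rewrite normr_gt0.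
have mf : measurable_fun setT (fun t : measurableTypeR R => a * t + b : measurableTypeR R)%R.
  by apply: measurable_funD => //; exact: mulrl_measurable.
pose m := [the {measure set _ -> \bar R} of
  mscale (NngNum (ltW ap)) (image_measure leb mf)].
have -> : \int[leb]_t f t = \int[m]_t f t.
  apply: eq_measure_integral => A mA _.
  by rewrite /= -(lebesgue_measure_affine b a0 mA).
rewrite ge0_integral_mscale//= ge0_integral_pushforward//= preimage_setT.
by rewrite muleA -EFinM mulVf ?gt_eqF// mul1e.
Qed.

End affine_change_of_variables.

Section row_affine.
Context {R : realType}.

Lemma rcons_rowE n (x : 'rV[R]_n.+1) :
  x = rcons_row (x 0 ord0) (\row_i x 0 (lift ord0 i)).
Proof.
apply/rowP => i; case: (unliftP ord0 i) => [j ->|->].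
  by rewrite rcons_rowS mxE.
by rewrite rcons_row0.
Qed.

Lemma rcons_row_affine n (a t b : R) (y c : 'rV[R]_n) :
  a *: rcons_row t y + rcons_row b c = rcons_row (a * t + b) (a *: y + c).
Proof.
by apply/rowP => i; rewrite !mxE; case: (unlift ord0 i) => [j|//]; rewrite !mxE.
Qed.

Lemma measurable_row_affine n (a : R) (b : 'rV[R]_n) :
  measurable_fun setT (fun x : 'rV[R]_n => a *: x + b).
Proof.
apply: measurable_rowP => i.
rewrite (_ : (fun _ => _) = (fun x : 'rV[R]_n => a * x 0 i + b 0 i)); last first.
  by apply/funext => x; rewrite !mxE.
apply: measurable_funD => //; apply: measurable_funM => //.
exact: coord_measurable.
Qed.

(** The map acts on each coordinate separately, so every step of the induction peels off one
    coordinate and contributes one factor [1/|a|]. *)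
Lemma ge0_integral_affine n (a : R) (b : 'rV[R]_n) (g : 'rV[R]_n -> \bar R) :
  a != 0 -> measurable_fun setT g -> (forall x, (0 <= g x)%E) ->
  (\int[rvmeas n]_x g (a *: x + b)%R =
   ((`|a| ^+ n)^-1)%:E * \int[rvmeas n]_x g x)%E.
Proof.
move=> a0; elim: n b g => [b g mg g0|n IH b g mg g0].
  rewrite expr0 invr1 mul1e; apply: eq_integral => x _.
  by congr g; rewrite (row0E (_ + _)) (row0E x).
have mr := @measurable_rcons_row R n.
rewrite integral_rvmeasS//; last first.
  exact: (measurableT_comp mg (measurable_row_affine _ _)).
rewrite integral_rvmeasS//.
pose G t := (\int[rvmeas n]_y g (rcons_row t y))%E.
have mG : measurable_fun setT (G : measurableTypeR R -> \bar R).
  exact: (measurable_fun_fubini_tonelli_F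
    (fun p : measurableTypeR R * 'rV[R]_n => g (rcons_row p.1 p.2))
    (measurableT_comp mg mr)).
have maff : measurable_fun setT
    (fun t : measurableTypeR R => a * t + b 0 ord0 : measurableTypeR R).
  by apply: measurable_funD => //; exact: mulrl_measurable.
have G0 t : (0 <= G t)%E by apply: integral_ge0 => y _.
transitivity (\int[lebesgue_measure]_t
    (((`|a| ^+ n)^-1)%:E * G (a * t + b 0 ord0)%R))%E.
  apply: eq_integral => t _.
  rewrite [b in LHS]rcons_rowE.
  under eq_integral do rewrite rcons_row_affine.
  rewrite (IH _ (fun y => g (rcons_row (a * t + b 0 ord0) y)))//.
  exact: (measurableT_comp (measurableT_comp mg mr) (measurable_pair1 _)).
have mGa := measurableT_comp mG maff.
rewrite (ge0_integralZl _ measurableT mGa (fun t _ => G0 _)); last first.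
  by rewrite lee_fin invr_ge0 exprn_ge0.
rewrite ge0_integral_affine1// muleA -EFinM; congr (_%:E * _)%E.
by rewrite exprSr invfM mulrC.
Qed.

End row_affine.

Section Rn_integral_rvmeas.
Context {R : realType} {n : nat}.
Implicit Types f : 'rV[R]_n -> R.

Lemma Rn_integrableE f : measurable_fun setT f ->
  Rn_integrable f <-> (rvmeas n).-integrable setT (EFin \o f).
Proof.
move=> mf; rewrite /Rn_integrable nnintE//; last first.
  apply/measurable_EFinP; exact: measurableT_comp.
split => [h|/integrableP[_]]; last exact.
by apply/integrableP; split => //; exact/measurable_EFinP.
Qed.

Lemma Rn_integralE f : (rvmeas n).-integrable setT (EFin \o f) ->
  Rn_integral f = \int[rvmeas n]_x f x.
Proof.
move=> fi; have /integrableP[/measurable_EFinP mf _] := fi.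
rewrite /Rn_integral /Rintegral integralE.
rewrite fineB; [|exact: integrable_pos_fin_num|exact: integrable_neg_fin_num].
rewrite !nnintE//.
- congr (fine _ - fine _); apply: eq_integral => x _.
    by rewrite funeposE /= -EFin_max.
  by rewrite funenegE /= -EFin_max.
- by apply/measurable_EFinP; apply: measurable_maxr => //; exact: measurable_funN.
- by move=> x; rewrite lee_fin le_max lexx orbT.
- by apply/measurable_EFinP; apply: measurable_maxr.
- by move=> x; rewrite lee_fin le_max lexx orbT.
Qed.

Lemma integrable_affine (a : R) (b : 'rV[R]_n) f : a != 0 ->
  (rvmeas n).-integrable setT (EFin \o f) ->
  (rvmeas n).-integrable setT (EFin \o (fun x => f (a *: x + b))).
Proof.
move=> a0 /integrableP[mf fi].
apply/integrableP; split.
  exact: (measurableT_comp mf (measurable_row_affine a b)).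
rewrite (ge0_integral_affine b (g := fun x => `|(f x)%:E|%E))//; last first.
  exact: measurableT_comp.
by rewrite lte_mul_pinfty// lee_fin invr_ge0 exprn_ge0.
Qed.

Lemma Rintegral_affine (a : R) (b : 'rV[R]_n) f : a != 0 ->
  (rvmeas n).-integrable setT (EFin \o f) ->
  \int[rvmeas n]_x f (a *: x + b) = (`|a| ^+ n)^-1 * \int[rvmeas n]_x f x.
Proof.
move=> a0 fi; have /integrableP[mf _] := fi.
have E1 : (\int[rvmeas n]_x (EFin \o (fun x => f (a *: x + b)%R))^\+ x =
    ((`|a| ^+ n)^-1)%:E * \int[rvmeas n]_x (EFin \o f)^\+ x)%E.
  rewrite -(ge0_integral_affine b a0 (measurable_funepos mf))//.
  by apply: eq_integral => x _; rewrite !funeposE.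
have E2 : (\int[rvmeas n]_x (EFin \o (fun x => f (a *: x + b)%R))^\- x =
    ((`|a| ^+ n)^-1)%:E * \int[rvmeas n]_x (EFin \o f)^\- x)%E.
  rewrite -(ge0_integral_affine b a0 (measurable_funeneg mf))//.
  by apply: eq_integral => x _; rewrite !funenegE.
have fp := integrable_pos_fin_num measurableT fi.
have fn := integrable_neg_fin_num measurableT fi.
rewrite /Rintegral integralE [in RHS]integralE [X in fine (X - _)%E = _]E1.
rewrite [X in fine (_ - X)%E = _]E2.
rewrite -muleBr//; last by rewrite fin_num_adde_defr// fin_numN.
by rewrite fineM// fin_numB fp fn.
Qed.

End Rn_integral_rvmeas.

(** * Limits and derivatives of integrals and along lines *)

Section under_integral.
Context {R : realType} d {Y : measurableType d} {mu : {measure set Y -> \bar R}}.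
Variables (D : set Y) (mD : measurable D).

(** The sequential theorem suffices because balls of radius [1/(k+1)] form a countable base at [a]:
    a failure of convergence would produce a sequence tending to [a] that contradicts it. The
    parameter space is left general since it will be [R], ['rV[R]_n] and their product. *)
Lemma cvg_Rintegral_dominated (X : pseudoMetricType R) (a : X)
    (f : X -> Y -> R) (g : Y -> R) :
  mu.-integrable D (EFin \o g) ->
  (\forall x \near a, mu.-integrable D (EFin \o f x) /\
     forall y, D y -> `|f x y| <= g y) ->
  (forall y, D y -> f x y @[x --> a] --> f a y) ->
  \int[mu]_(y in D) f x y @[x --> a] --> \int[mu]_(y in D) f a y.
Proof.
move=> ig nf cf; apply/cvgrPdist_lt => e e0; apply: contrapT => nn.
have /choice[u Hu] : forall k : nat, exists x : X,
    [/\ ball a k.+1%:R^-1 x,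
        mu.-integrable D (EFin \o f x) /\ (forall y, D y -> `|f x y| <= g y) &
        ~ `|\int[mu]_(y in D) f a y - \int[mu]_(y in D) f x y| < e].
  move=> k; apply: contrapT => nx; apply: nn.
  near=> x; apply: contrapT => nlt; apply: nx; exists x; split => //.
    by near: x; apply: nbhsx_ballx; rewrite invr_gt0.
  by near: x.
have ua : u k @[k --> \oo] --> a.
  apply/cvg_ballP => r r0; near=> k.
  have [+ _ _] := Hu k; apply: le_ball.
  rewrite -[leRHS]invrK lef_pV2 ?posrE ?invr_gt0//.
  apply: (@le_trans _ _ k%:R); last by rewrite ler_nat.
  by near: k; exact: nbhs_infty_ger.
have [ifa fag] := nbhs_singleton nf.
have mf k : measurable_fun D (fun y => (f (u k) y)%:E).
  by have [_ [/integrableP[] ]] := Hu k.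
have [||||h1 _ h3] := @dominated_convergence _ _ _ mu D mD
  (fun k y => (f (u k) y)%:E) (fun y => (f a y)%:E) (EFin \o g) mf.
- by have /integrableP[] := ifa.
- apply: aeW => y Dy; apply: cvg_EFin; first exact: nearW.
  by apply: (cvg_comp u (fun x => f x y) ua); exact: cf.
- exact: ig.
- by apply: aeW => y k Dy; rewrite lee_fin; have [_ [_ hg] _] := Hu k; exact: hg.
have h4 : \int[mu]_(y in D) f (u k) y @[k --> \oo] --> \int[mu]_(y in D) f a y.
  apply: fine_cvg; rewrite /Rintegral fineK//; exact: integrable_fin_num.
move/cvgrPdist_lt : h4 => /(_ _ e0)[N _ /(_ N)/= hN].
by have [_ _] := Hu N; apply; apply: hN.
Unshelve. all: by end_near. Qed.

Lemma is_derive_Rintegral (f df : R -> Y -> R) (g : Y -> R) (a e : R) :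
  0 < e ->
  (forall h, `|h - a| < e -> mu.-integrable D (EFin \o f h)) ->
  (forall h y, `|h - a| < e -> D y -> is_derive h 1 (f^~ y) (df h y)) ->
  mu.-integrable D (EFin \o g) ->
  (forall h y, `|h - a| < e -> D y -> `|df h y| <= g y) ->
  is_derive a 1 (fun h => \int[mu]_(y in D) f h y) (\int[mu]_(y in D) df a y).
Proof.
move=> e0 If dff ig dfg.
have Ie h : `](a - e), (a + e)[%classic h -> `|h - a| < e.
  by rewrite /= in_itv /= ltr_distl.
have Ia : `](a - e), (a + e)[%classic a.
  by rewrite /= in_itv /= ltrBlDr ltrDl e0.
have i2 : forall h, `](a - e), (a + e)[%classic h -> mu.-integrable D (EFin \o f h).
  by move=> h /Ie; exact: If.
have i3 : forall h y, `](a - e), (a + e)[%classic h -> D y -> derivable (f^~ y) h 1.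
  by move=> h y /Ie hh Dy; have [] := dff h y hh Dy.
have d1 h y : `](a - e), (a + e)[%classic h -> D y ->
    partial1of2 f h y = df h y.
  by move=> /Ie hh Dy; rewrite partial1of2E; have [_ ->] := dff h y hh Dy.
have i4 : mu.-integrable D (EFin \o (fun y => `|g y|)).
  exact: (integrable_norm ig).
have i5 : forall h y, `](a - e), (a + e)[%classic h -> D y ->
    `|partial1of2 f h y| <= `|g y|.
  move=> h y hI Dy; rewrite d1// (le_trans _ (ler_norm _))// dfg//; exact: Ie.
have H := @derivable_under_integral _ _ _ mu f D mD _ _ _ Ia i2 i3
  (fun y => `|g y|) (fun y => normr_ge0 _) i4 i5.
apply: DeriveDef => //.
rewrite -derive1E (@differentiation_under_integral _ _ _ mu f D mD _ _ _ Ia i2 i3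
  (fun y => `|g y|) (fun y => normr_ge0 _) i4 i5).
by apply: eq_Rintegral => y /[!inE] Dy; exact: d1.
Qed.

End under_integral.

Section derive_line.
Context {R : realType}.

Lemma is_derive_line (V W : normedModType R) (f : V -> W) (p v : V) (s : R) :
  derivable f (p + s *: v) v ->
  is_derive s 1 (fun s => f (p + s *: v)) ('D_v f (p + s *: v)).
Proof.
move=> df.
have E : (fun h => h^-1 *: (f (p + (h *: 1 + s) *: v) - f (p + s *: v))) =
         (fun h => h^-1 *: (f (h *: v + (p + s *: v)) - f (p + s *: v))).
  apply/funext => h; congr (_ *: (f _ - _)).
  by rewrite (_ : h *: (1 : R) = h) ?scalerDl 1?addrCA//; exact: mulr1.
apply: DeriveDef; first by rewrite /derivable /= E.
by rewrite /derive /= E.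
Qed.

(** The two difference quotients coincide as functions of [h]. This reduces a partial derivative of
    an integral to a derivative in one real parameter, where differentiation under the integral
    applies. *)
Lemma is_derive_line0 (V W : normedModType R) (f : V -> W) (x v : V) (d : W) :
  is_derive (0 : R) 1 (fun h => f (x + h *: v)) d -> is_derive x v f d.
Proof.
move=> dg.
have E : (fun h : R => h^-1 *: (f (x + (h *: (1 : R) + 0) *: v) - f (x + (0 : R) *: v))) =
         (fun h => h^-1 *: (f (h *: v + x) - f x)).
  apply/funext => h; have e : h *: (1 : R) + 0 = h by rewrite addr0; exact: mulr1.
  by congr (_ *: (f _ - f _)); rewrite ?e ?scale0r ?addr0// addrC.
apply: DeriveDef; first by have [] := dg; rewrite /derivable /= E.
by have [_] := dg; rewrite /derive /= E.
Qed.

Variable n : nat.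
Implicit Types (f : 'rV[R]_n -> R).

Lemma norm_ebase (i : 'I_n) : `|ebase R i| = 1.
Proof.
rewrite [LHS]/normr /= mx_normrE; apply/le_anti/andP; split.
  apply/bigmax_leP; split => // -[j k] _ /=; rewrite mxE.
  by case: (_ && _); rewrite /= ?normr1 ?normr0.
apply/bigmax_geP; right; exists (0, i) => //=.
by rewrite mxE !eqxx normr1.
Qed.

Lemma row_coord_le (x : 'rV[R]_n) i : `|x 0 i| <= `|x|.
Proof.
rewrite [leRHS]/normr /= mx_normrE; apply/bigmax_geP; right.
by exists (0, i).
Qed.

Lemma row_norm_le (x : 'rV[R]_n) c : 0 <= c -> (forall i, `|x 0 i| <= c) ->
  `|x| <= c.
Proof.
move=> c0 h; rewrite [leLHS]/normr /= mx_normrE; apply/bigmax_leP; split => //.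
by move=> [i j] _ /=; rewrite (ord1 i).
Qed.

Lemma MVT_coord f (i : 'I_n) (p : 'rV[R]_n) (c : R) :
  (forall x, derivable f x (ebase R i)) ->
  exists2 q, `|q - p| <= `|c| &
    f (p + c *: ebase R i) - f p = c * 'D_(ebase R i) f q.
Proof.
move=> df.
have df' (s : R) : is_derive s 1 (fun s => f (p + s *: ebase R i))
    ('D_(ebase R i) f (p + s *: ebase R i)) by exact: is_derive_line.
have cf (s : R) : {for s, continuous (fun s : R => f (p + s *: ebase R i))}.
  by apply/differentiable_continuous/derivable1_diffP; have [] := df' s.
have nrm (s : R) : `|p + s *: ebase R i - p| = `|s|.
  by rewrite addrAC subrr add0r normrZ norm_ebase mulr1.
have [c0|c0|->] := ltgtP c 0; last first.
- exists p; first by rewrite subrr !normr0.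
  by rewrite scale0r addr0 subrr mul0r.
- have [s] := @MVT_segment _ _ _ _ _ (ltW c0) (fun s _ => df' s)
    (continuous_subspaceT cf).
  rewrite in_itv /= => /andP[s0 cs] E.
  exists (p + s *: ebase R i); first by rewrite nrm !ger0_norm// ltW.
  by move: E; rewrite scale0r addr0 => ->; rewrite subr0 mulrC.
- have [s] := @MVT_segment _ _ _ _ _ (ltW c0) (fun s _ => df' s)
    (continuous_subspaceT cf).
  rewrite in_itv /= => /andP[cs s0] E.
  exists (p + s *: ebase R i); first by rewrite nrm !ler0_norm// ?lerN2// ltW.
  apply/eqP; rewrite -eqr_opp opprB; apply/eqP.
  by move: E; rewrite scale0r addr0 => ->; rewrite sub0r mulrN mulrC.
Qed.

(** The path from [a] to [b] changes one coordinate at a time. Each corner is within [|b - a|] of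
    [a] and each mean-value point within [|b - a|] of its corner, whence the factor [2]. *)
Lemma MVT_row f (a b : 'rV[R]_n) :
  (forall i x, derivable f x (ebase R i)) ->
  exists q : 'I_n -> 'rV[R]_n, (forall i, `|q i - a| <= 2 * `|b - a|) /\
    f b - f a = \sum_(i < n) (b 0 i - a 0 i) * 'D_(ebase R i) f (q i).
Proof.
move=> df.
pose w k := \row_(i < n) (if (i < k)%N then b 0 i else a 0 i).
have w0 : w 0%N = a by apply/rowP => i; rewrite mxE.
have wn : w n = b by apply/rowP => i; rewrite mxE ltn_ord.
have wS (k : 'I_n) : w k.+1 = w k + (b 0 k - a 0 k) *: ebase R k.
  apply/rowP => i; rewrite !mxE eqxx /= ltnS leq_eqVlt.
  have [->|ik] := eqVneq i k; first by rewrite eqxx ltnn /= mulr1 addrC subrK.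
  by rewrite (negbTE (_ : nat_of_ord i != k)) //= mulr0 addr0.
have wa k : `|w k - a| <= `|b - a|.
  apply: row_norm_le => // i; rewrite !mxE; case: ifP => _.
    by have := row_coord_le (b - a) i; rewrite !mxE.
  by rewrite subrr normr0.
have /choice[q Hq] : forall k : 'I_n, exists q, `|q - w k| <= `|b 0 k - a 0 k| /\
    f (w k.+1) - f (w k) = (b 0 k - a 0 k) * 'D_(ebase R k) f q.
  move=> k; rewrite wS.
  by have [q ? ?] := MVT_coord (w k) (b 0 k - a 0 k) (df k); exists q.
exists q; split => [k|].
  have [h _] := Hq k.
  rewrite -(subrK (w k) (q k)) -addrA (le_trans (ler_normD _ _))// mulr2n mulrDl.
  rewrite mul1r lerD// (le_trans h)//.
  by have := row_coord_le (b - a) k; rewrite !mxE.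
have -> : f b - f a = \sum_(0 <= k < n) (f (w k.+1) - f (w k)).
  by rewrite telescope_sumr// w0 wn.
rewrite big_mkord.
by apply: eq_bigr => k _; have [_ ->] := Hq k.
Qed.

(** [smooth] speaks of partial derivatives only, so the chain rule is derived from their continuity:
    the mean-value points of [MVT_row] are squeezed to [c t]. *)
Lemma is_derive_comp_row f (c : R -> 'rV[R]_n) (dc : 'rV[R]_n) (t : R) :
  (forall i x, derivable f x (ebase R i)) ->
  (forall i, continuous ('D_(ebase R i) f)) ->
  is_derive t 1 c dc ->
  is_derive t 1 (f \o c) (\sum_(i < n) dc 0 i * 'D_(ebase R i) f (c t)).
Proof.
move=> df cdf dct.
have /choice[q Hq] : forall h : R, exists q : 'I_n -> 'rV[R]_n,
    (forall i, `|q i - c t| <= 2 * `|c (h *: 1 + t) - c t|) /\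
    f (c (h *: 1 + t)) - f (c t) =
      \sum_(i < n) (c (h *: 1 + t) 0 i - c t 0 i) * 'D_(ebase R i) f (q i).
  by move=> h; exact: MVT_row.
have cc : c (h *: 1 + t) @[h --> 0^'] --> c t.
  have : {for t, continuous c}.
    by apply/differentiable_continuous/derivable1_diffP; have [] := dct.
  move=> ct.
  have ht : h *: 1 + t @[h --> (0:R)^'] --> t.
    apply: cvg_within_filter.
    have -> : (fun h : R => h *: (1 : R) + t) = (fun h => h + t).
      by apply/funext => h; congr (_ + _); exact: mulr1.
    have : h + t @[h --> (0 : R)] --> 0 + t.
      by apply: cvgD; [exact: cvg_id|exact: cvg_cst].
    by rewrite add0r.
  exact: (cvg_comp _ _ ht ct).
suff H : h^-1 *: ((f \o c) (h *: 1 + t) - (f \o c) t) @[h --> 0^'] -->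
    \sum_(i < n) dc 0 i * 'D_(ebase R i) f (c t).
  apply: DeriveDef; first by apply/cvg_ex; eexists; exact: H.
  exact/cvg_lim.
have -> : (fun h => h^-1 *: ((f \o c) (h *: 1 + t) - (f \o c) t)) =
    (fun h => \sum_(i < n) (h^-1 *: (c (h *: 1 + t) - c t)) 0 i *
       'D_(ebase R i) f (q h i)).
  apply/funext => h /=; have [_ ->] := Hq h.
  rewrite [LHS]mulr_sumr; apply: eq_bigr => i _; by rewrite !mxE mulrA.
apply: cvg_big => [|i _]; first exact: add_continuous.
apply: cvgM.
  have : h^-1 *: (c (h *: 1 + t) - c t) @[h --> 0^'] --> dc.
    by have [dd <-] := dct.
  move=> h1; apply: (@cvg_comp _ _ _ (fun h : R => h^-1 *: (c (h *: 1 + t) - c t))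
    (fun M : 'rV[R]_n => M 0 i) _ _ _ h1).
  exact: coord_continuous.
have qc : q h i @[h --> 0^'] --> c t.
  apply/cvgrPdist_lt => e e0.
  move/cvgrPdist_lt : cc => /(_ (e / 2)) cc.
  near=> h; rewrite distrC; have [/(_ i) h1 _] := Hq h.
  rewrite (le_lt_trans h1)// mulrC -ltr_pdivlMr// distrC.
  by near: h; apply: cc; rewrite divr_gt0.
exact: (cvg_comp _ _ qc (cdf i _)).
Unshelve. all: by end_near. Qed.

End derive_line.

(** * Bounded densities of bounded support, integrated against [psi] and its partial derivatives *)

(** * Integrals against a bump function *)

Section density_bump.
Context {R : realType} {n : nat}.
Notation rV := 'rV[R]_n.
Notation mu := (@rvmeas R n).
Implicit Types (E chi : rV -> R) (t : R) (x y z : rV).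

(** This class is stable under what the proof does to [E]: multiplying by a kernel, changing signs
    pointwise, subtracting a multiple of the indicator of a cube. The explicit [L] and [M] make the
    resulting bounds uniform. *)
Definition density (L M : R) E :=
  [/\ measurable_fun setT E, (forall y, `|E y| <= M) &
      forall y, ~ cube L y -> E y = 0].

Definition bump_fun (Z C : R) chi :=
  [/\ continuous chi, (forall z, `|chi z| <= C) & forall z, Z < `|z| -> chi z = 0].

Lemma cube_finite_rvmeas : cube_finite mu.
Proof. exact: (svalP (@radon_row_rec R n)). Qed.

Lemma integrable_cube (L : R) : mu.-integrable setT (EFin \o \1_(@cube R n L)).
Proof.
apply/integrableP; split.
  by apply/measurable_EFinP; apply: measurable_indic; exact: measurable_cube.
rewrite (eq_integral (fun x => (\1_(@cube R n L) x)%:E)); last first.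
  by move=> t _; rewrite gee0_abs// lee_fin.
by rewrite integral_indic ?setIT//; [exact: cube_finite_rvmeas|exact: measurable_cube].
Qed.

Lemma cubeP (L : R) y : `|y| < L -> cube L y.
Proof. by move=> h i; apply: le_lt_trans h; exact: row_coord_le. Qed.

Lemma density_integrable L M E : density L M E -> mu.-integrable setT (EFin \o E).
Proof.
move=> [mE bE sE].
apply: (@le_integrable _ _ _ mu _ measurableT _ (EFin \o (fun y => M * \1_(@cube R n L) y))).
- exact/measurable_EFinP.
- move=> y _; rewrite lee_fin normrM.
  have M0 : 0 <= M by apply: le_trans (bE y).
  have [cy|cy] := pselect (cube L y).
    by rewrite indicE mem_set// normr1 mulr1 (ger0_norm M0).
  by rewrite sE// normr0 mulr_ge0.
- rewrite (_ : EFin \o _ = (fun y => M%:E * (EFin \o \1_(@cube R n L)) y)%E)//.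
  by apply: integrableZl => //; exact: integrable_cube.
Qed.

Lemma le_Rintegral_density L M E : density L M E -> 0 <= M ->
  `|\int[mu]_y E y| <= M * fine (mu (@cube R n L)).
Proof.
move=> dE M0; have iE := density_integrable dE; have [mE bE sE] := dE.
have -> : M * fine (mu (@cube R n L)) = \int[mu]_y (M * \1_(@cube R n L) y).
  rewrite RintegralZl//; last exact: integrable_cube.
  congr (_ * _); rewrite /Rintegral integral_indic ?setIT//.
  exact: measurable_cube.
apply: (le_trans (le_normr_Rintegral measurableT iE)).
apply: le_Rintegral => //.
- exact: (integrable_norm iE).
- rewrite (_ : EFin \o _ = (fun y => M%:E * (EFin \o \1_(@cube R n L)) y)%E)//.
  by apply: integrableZl => //; exact: integrable_cube.
- move=> y _; have [cy|cy] := pselect (cube L y).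
    by rewrite indicE mem_set// mulr1 bE.
  by rewrite sE// normr0 mulr_ge0.
Qed.

Lemma density_mul L M B E (q : rV -> R) : density L M E -> measurable_fun setT q ->
  0 <= M -> 0 <= B -> (forall y, cube L y -> `|q y| <= B) ->
  density L (M * B) (fun y => E y * q y).
Proof.
move=> [mE bE sE] mq M0 B0 bq; split.
- exact: measurable_funM.
- move=> y; rewrite normrM; have [cy|cy] := pselect (cube L y).
    by rewrite ler_pM// bq.
  by rewrite sE// normr0 mul0r mulr_ge0.
- by move=> y cy; rewrite sE// mul0r.
Qed.

End density_bump.

(** * The map [P_t] and the two moments of a density against a bump function *)

Section segment_point.
Context {R : realType} {n : nat}.
Notation rV := 'rV[R]_n.
Notation mu := (@rvmeas R n).

Definition pt (t : R) (x y : rV) : rV := y + t^-1 *: (x - y).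

Lemma ptE t x y : pt t x y = (1 - t^-1) *: y + t^-1 *: x.
Proof.
by apply/rowP => i; rewrite !mxE; ring.
Qed.

Lemma pt_line t x v y h : pt t (x + h *: v) y = pt t x y + h *: (t^-1 *: v).
Proof. by apply/rowP => i; rewrite !mxE; ring. Qed.

(** Source of the extra power of [t]: where [P_t(x, y)] lies in a fixed bounded set, [x - y] is of
    order [t]. *)
Lemma pt_subE t x y : 0 < t < 1 -> x - y = (t / (1 - t)) *: (pt t x y - x).
Proof.
move=> /andP[t0 t1].
rewrite (_ : pt t x y - x = (t^-1 - 1) *: (x - y)); last first.
  by apply/rowP => i; rewrite !mxE; ring.
rewrite scalerA (_ : _ * _ = 1) ?scale1r//.
by field; rewrite gt_eqF// subr_eq0 gt_eqF.
Qed.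

Lemma measurable_pt_comp t x (chi : rV -> R) : continuous chi ->
  measurable_fun setT (fun y => chi (pt t x y)).
Proof.
move=> cc; under eq_fun do rewrite ptE.
apply: (measurableT_comp (continuous_measurable_row cc)).
exact: measurable_row_affine.
Qed.

Lemma measurable_coordB (x : rV) i : measurable_fun setT (fun y : rV => (x - y) 0 i).
Proof.
rewrite (_ : (fun _ => _) = (fun y : rV => x 0 i - y 0 i)); last first.
  by apply/funext => y; rewrite !mxE.
by apply: measurable_funB => //; exact: coord_measurable.
Qed.

Lemma cvg_pt (t : R) (x y : rV) : t != 0 ->
  (fun p : R * rV => pt p.1 p.2 y) @ nbhs (t, x) --> pt t x y.
Proof.
move=> t0; apply: cvgD; first exact: cvg_cst.
apply: cvgZ; first by apply: cvgV => //; exact: cvg_fst.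
by apply: cvgB; [exact: cvg_snd|exact: cvg_cst].
Qed.

Lemma cvg_comp_pt (chi : rV -> R) (t : R) (x y : rV) : continuous chi -> t != 0 ->
  (fun p : R * rV => chi (pt p.1 p.2 y)) @ nbhs (t, x) --> chi (pt t x y).
Proof.
move=> cc t0.
apply: (@cvg_comp _ _ _ (fun p : R * rV => pt p.1 p.2 y) chi _ _ _
  (@cvg_pt t x y t0)).
exact: cc.
Qed.

Lemma Rintegral_pt t x (G : rV -> R) : 0 < t < 1 ->
  mu.-integrable setT (EFin \o G) ->
  \int[mu]_y G (pt t x y) = (t / (1 - t)) ^+ n * \int[mu]_z G z.
Proof.
move=> /andP[t0 t1] iG.
have a0 : 1 - t^-1 != 0.
  by rewrite subr_eq0 eq_sym invr_eq1 lt_eqF.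
under eq_Rintegral do rewrite ptE.
rewrite Rintegral_affine// -exprVn; congr (_ ^+ _ * _).
have -> : 1 - t^-1 = - ((1 - t) / t) by field; rewrite gt_eqF.
by rewrite normrN gtr0_norm ?invf_div// divr_gt0// subr_gt0.
Qed.

Lemma integrable_pt t x (G : rV -> R) : t != 0 -> t != 1 ->
  mu.-integrable setT (EFin \o G) ->
  mu.-integrable setT (EFin \o (fun y => G (pt t x y))).
Proof.
move=> t0 t1 iG.
have a0 : 1 - t^-1 != 0 by rewrite subr_eq0 eq_sym invr_eq1.
under [X in EFin \o X]eq_fun do rewrite ptE.
exact: integrable_affine.
Qed.

Section transforms.
Variables (L M Z C : R) (E chi : rV -> R).
Hypotheses (L0 : 0 <= L) (dE : density L M E) (bchi : bump_fun Z C chi).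

(** [gk], [dgk] and [Ak] are combinations of these two integrals with powers of [t]. Both functions
    stay as arguments because [E] is also replaced by an indicator or by [E - E(x)], and [psi] by
    its partial derivatives. *)
Definition I0 (E chi : rV -> R) (t : R) (x : rV) := \int[mu]_y (E y * chi (pt t x y)).
Definition I1 (E chi : rV -> R) (i : 'I_n) (t : R) (x : rV) :=
  \int[mu]_y (E y * ((x - y) 0 i * chi (pt t x y))).

Lemma density_M_ge0 : 0 <= M.
Proof. by have [_ h _] := dE; exact: le_trans (h 0). Qed.

Lemma bump_C_ge0 : 0 <= C.
Proof. by have [_ h _] := bchi; exact: le_trans (h 0). Qed.

Lemma coordB_le (x y : rV) (i : 'I_n) : cube L y -> `|(x - y) 0 i| <= `|x| + L.
Proof.
move=> cy; rewrite !mxE (le_trans (ler_normB _ _))// lerD ?row_coord_le//.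
exact: ltW.
Qed.

Lemma density_I0 t x : density L (M * C) (fun y => E y * chi (pt t x y)).
Proof.
have [cc bc _] := bchi; apply: density_mul => //.
- exact: measurable_pt_comp.
- exact: density_M_ge0.
- exact: bump_C_ge0.
Qed.

Lemma density_I1 i t x r : `|x| <= r ->
  density L (M * ((r + L) * C)) (fun y => E y * ((x - y) 0 i * chi (pt t x y))).
Proof.
move=> xr; have r0 : 0 <= r by exact: le_trans xr.
have [cc bc _] := bchi; apply: density_mul => //.
- by apply: measurable_funM; [exact: measurable_coordB|exact: measurable_pt_comp].
- exact: density_M_ge0.
- by rewrite mulr_ge0 ?bump_C_ge0// addr_ge0.
- move=> y cy; rewrite normrM ler_pM//.
  by rewrite (le_trans (coordB_le _ _ cy))// lerD2r.
Qed.

Lemma density_le_cube K G y : density L K G -> `|G y| <= K * \1_(@cube R n L) y.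
Proof.
move=> [_ bG sG]; have [cy|cy] := pselect (cube L y).
  by rewrite indicE mem_set// mulr1.
by rewrite sG// normr0 mulr_ge0//; exact: le_trans (bG 0).
Qed.

Lemma integrable_scaled_cube K :
  mu.-integrable setT (EFin \o (fun y => K * \1_(@cube R n L) y)).
Proof.
rewrite (_ : EFin \o _ = (fun y => K%:E * (EFin \o \1_(@cube R n L)) y)%E)//.
by apply: integrableZl => //; exact: integrable_cube.
Qed.

(** Continuity is joint in [(t, x)]: one section gives measurability in [t], the other continuity in
    [x] under the [t]-integral. *)
Lemma cvg_I0 (t : R) (x : rV) : t != 0 ->
  (fun p : R * rV => I0 E chi p.1 p.2) @ nbhs (t, x) --> I0 E chi t x.
Proof.
move=> t0.
apply: (cvg_Rintegral_dominated measurableT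
  (f := fun (p : R * rV) y => E y * chi (pt p.1 p.2 y))
  (integrable_scaled_cube (M * C))).
- near=> p; split; first exact: density_integrable (density_I0 _ _).
  by move=> y _; exact: density_le_cube (density_I0 _ _).
- move=> y _; apply: cvgM; first exact: cvg_cst.
  by have [cc _ _] := bchi; exact: cvg_comp_pt.
Unshelve. all: by end_near. Qed.

Lemma cvg_I1 i (t : R) (x : rV) : t != 0 ->
  (fun p : R * rV => I1 E chi i p.1 p.2) @ nbhs (t, x) --> I1 E chi i t x.
Proof.
move=> t0.
apply: (cvg_Rintegral_dominated measurableT
  (f := fun (p : R * rV) y => E y * ((p.2 - y) 0 i * chi (pt p.1 p.2 y)))
  (integrable_scaled_cube (M * ((`|x| + 1 + L) * C)))).
- near=> p.
  have px : `|p.2| <= `|x| + 1.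
    rewrite -(subrK x p.2) addrC (le_trans (ler_normD _ _))// lerD2l.
    rewrite distrC ltW//; near: p.
    have /cvgrPdist_lt h : (fun p : R * rV => p.2) @ nbhs (t, x) --> x.
      exact: cvg_snd.
    exact: h.
  split; first exact: density_integrable (density_I1 _ _ px).
  by move=> y _; exact: density_le_cube (density_I1 _ _ px).
- move=> y _; apply: cvgM; first exact: cvg_cst.
  apply: cvgM.
    have h : (fun p : R * rV => p.2 - y) @ nbhs (t, x) --> x - y.
      by apply: cvgB; [exact: cvg_snd|exact: cvg_cst].
    apply: (@cvg_comp _ _ _ (fun p : R * rV => p.2 - y)
      (fun M : rV => M 0 i) _ _ _ h).
    exact: coord_continuous.
  by have [cc _ _] := bchi; exact: cvg_comp_pt.
Unshelve. all: by end_near. Qed.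

End transforms.
End segment_point.

Section Rintegral_sum.
Context {R : realType} d {T : measurableType d} {mu : {measure set T -> \bar R}}.
Variables (D : set T) (mD : measurable D) (I : Type) (f : I -> T -> R).
Hypothesis fi : forall i, mu.-integrable D (EFin \o f i).

Lemma integrable_Rsum (s : seq I) :
  mu.-integrable D (EFin \o (fun x => \sum_(i <- s) f i x)).
Proof.
elim: s => [|i s IH].
  rewrite (_ : EFin \o _ = cst 0%E); first exact: integrable0.
  by apply/funext => x /=; rewrite big_nil.
rewrite (_ : EFin \o _ =
    (fun x => (f i x)%:E + (\sum_(j <- s) f j x)%R%:E)%E).
  exact: (integrableD mD (fi i) IH).
by apply/funext => x /=; rewrite big_cons EFinD.
Qed.

Lemma Rintegral_sum (s : seq I) :
  \int[mu]_(x in D) (\sum_(i <- s) f i x) = \sum_(i <- s) \int[mu]_(x in D) f i x.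
Proof.
elim: s => [|i s IH].
  rewrite big_nil; under eq_Rintegral do rewrite big_nil.
  by rewrite /Rintegral integral0.
rewrite big_cons -IH -RintegralD//; last exact: integrable_Rsum.
by apply: eq_Rintegral => x _; rewrite big_cons.
Qed.

End Rintegral_sum.

(** * Differentiation of the moments in [x] and in [t] *)

Section transform_derivatives.
Context {R : realType} {n : nat}.
Notation rV := 'rV[R]_n.
Notation mu := (@rvmeas R n).

Definition bump1 (Z C : R) (psi : rV -> R) :=
  [/\ bump_fun Z C psi, forall i x, derivable psi x (ebase R i) &
      forall i, bump_fun Z C ('D_(ebase R i) psi)].

Variables (L M Z C : R) (E psi : rV -> R).
Hypotheses (L0 : 0 <= L) (dE : density L M E) (bpsi : bump1 Z C psi).
Let M0 : 0 <= M := density_M_ge0 dE.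
Let bp : bump_fun Z C psi. Proof. by have [] := bpsi. Qed.
Let bdp i : bump_fun Z C ('D_(ebase R i) psi). Proof. by have [] := bpsi. Qed.
Let cdp i : continuous ('D_(ebase R i) psi). Proof. by have [] := bdp i. Qed.
Let C0 : 0 <= C := bump_C_ge0 bp.

Lemma is_derive_affine (V : normedModType R) (p w : V) (h : R) :
  is_derive h 1 (fun h : R => p + h *: w) w.
Proof.
apply: (is_derive_eq (@is_derive_line _ _ _ (fun x : V => x) p w h _)).
  exact: derivable_id.
exact: derive_id.
Qed.

Lemma is_derive_bump_line (p w : rV) (h : R) :
  is_derive h 1 (fun h : R => psi (p + h *: w))
    (\sum_(i < n) w 0 i * 'D_(ebase R i) psi (p + h *: w)).
Proof.
have [_ dpsi _] := bpsi.
apply: (@is_derive_comp_row _ _ psi (fun h : R => p + h *: w)).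
- by move=> i x; exact: dpsi.
- by move=> i; have [] := bdp i.
- exact: is_derive_affine.
Qed.

(** Product rule under the integral: moving [x] along the [j]-th axis, [(x - y)_i] has derivative
    [(i == j)%:R], and [psi (pt t x y)] has derivative [t^-1] times the [j]-th partial
    derivative. *)
Lemma is_derive_I1 i j (t : R) (x : rV) :
  is_derive x (ebase R j) (I1 E psi i t)
    ((i == j)%:R * I0 E psi t x + t^-1 * I1 E ('D_(ebase R j) psi) i t x).
Proof.
apply: is_derive_line0.
pose xh h := x + h *: ebase R j.
pose df h y := E y * ((i == j)%:R * psi (pt t (xh h) y) +
   (xh h - y) 0 i * (t^-1 * 'D_(ebase R j) psi (pt t (xh h) y))).
have xh0 : xh 0 = x by rewrite /xh scale0r addr0.
have xhle (h : R) : `|h - 0| < 1 -> `|xh h| <= `|x| + 1.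
  rewrite subr0 => h1; rewrite (le_trans (ler_normD _ _))// lerD2l.
  by rewrite normrZ norm_ebase mulr1 ltW.
(* The displacement is kept below [1], so [|x| + 1 + L] dominates the coordinates of [xh h - y] on
   the support of [E], uniformly in [h]. *)
have B0 : 0 <= C + (`|x| + 1 + L) * (`|t^-1| * C).
  by rewrite addr_ge0// !mulr_ge0// !addr_ge0.
have dd (h : R) : `|h - 0| < 1 ->
    density L (M * (C + (`|x| + 1 + L) * (`|t^-1| * C))) (df h).
  move=> h1; apply: density_mul => //.
    apply: measurable_funD; apply: measurable_funM => //.
    - by apply: measurable_pt_comp; have [] := bp.
    - exact: measurable_coordB.
    - apply: measurable_funM => //.
      exact: (measurable_pt_comp t (xh h) (@cdp j)).
  move=> y cy; rewrite (le_trans (ler_normD _ _))// lerD//.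
    rewrite normrM; have [_ h2 _] := bp.
    case: (i == j); first by rewrite normr1 mul1r.
    by rewrite normr0 mul0r.
  rewrite !normrM ler_pM// ?mulr_ge0//.
    by rewrite (le_trans (coordB_le _ _ cy))// lerD2r xhle.
  by rewrite ler_pM//; have [_ h2 _] := bdp j.
have dd0 (h : R) (y : rV) : `|h - 0| < 1 -> setT y -> is_derive h 1
    (fun h : R => E y * ((xh h - y) 0 i * psi (pt t (xh h) y))) (df h y).
  move=> h1 _.
  have H1 : is_derive h 1 (fun h : R => (xh h - y) 0 i) (i == j)%:R.
    rewrite (_ : (fun h => _) = (fun h : R => (x - y) 0 i + h *: ((i == j)%:R : R))).
      exact: is_derive_affine.
    by apply/funext => k; rewrite !mxE /= addrAC.
  have H2 : is_derive h 1 (fun h : R => psi (pt t (xh h) y))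
      (t^-1 * 'D_(ebase R j) psi (pt t (xh h) y)).
    have := is_derive_bump_line (pt t x y) (t^-1 *: ebase R j) h.
    under [X in is_derive _ _ X _]eq_fun do rewrite -pt_line.
    rewrite (bigD1 j)//= big1 ?addr0; last first.
      by move=> k kj; rewrite !mxE (negbTE kj) andbF mulr0 mul0r.
    by rewrite !mxE !eqxx mulr1 -pt_line.
  apply: (is_derive_eq (is_deriveM (is_derive_cst (E y) h 1) (is_deriveM H1 H2))).
  by rewrite /df /GRing.scale /=; ring.
have H := is_derive_Rintegral measurableT ltr01
  (fun h h1 => density_integrable (density_I1 L0 dE bp i t (xhle h h1))) dd0
  (integrable_scaled_cube L (M * (C + (`|x| + 1 + L) * (`|t^-1| * C))))
  (fun h y h1 _ => density_le_cube y (dd h h1)).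
apply: (is_derive_eq H).
have iA := density_integrable (density_I0 dE bp t x).
have iB := density_integrable (density_I1 L0 dE (bdp j) i t (lexx `|x|)).
rewrite /df xh0 /I0 /I1 -(RintegralZl _ measurableT iA).
rewrite -(RintegralZl _ measurableT iB) -RintegralD//.
- by apply: eq_Rintegral => y _; ring.
- rewrite (_ : EFin \o _ = (fun y => ((i == j)%:R)%:E * (E y * psi (pt t x y))%:E)%E)//.
  exact: integrableZl.
- rewrite (_ : EFin \o _ = (fun y => (t^-1)%:E *
    (E y * ((x - y) 0 i * 'D_(ebase R j) psi (pt t x y)))%:E)%E)//.
  exact: integrableZl.
Qed.

Lemma is_derive_I0 (t : R) (x : rV) : 0 < t ->
  is_derive t 1 (fun s => I0 E psi s x)
    (- (t ^- 2) * \sum_(i < n) I1 E ('D_(ebase R i) psi) i t x).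
Proof.
move=> t0.
(* Staying within [t / 2] of [t] keeps [h] above [t / 2], so that the factor [h^-2] of the
   derivative is dominated. *)
have e0 : 0 < t / 2 by rewrite divr_gt0.
have ht (h : R) : `|h - t| < t / 2 -> t / 2 < h.
  by rewrite ltr_distl => /andP[h1 _]; lra.
pose q (h : R) (y : rV) := - (h ^- 2) *
  \sum_(i < n) (x - y) 0 i * 'D_(ebase R i) psi (pt h x y).
pose B := (t / 2) ^- 2 * \sum_(i < n) ((`|x| + L) * C).
have B0 : 0 <= B.
  apply: mulr_ge0; first by rewrite invr_ge0 exprn_ge0// ltW.
  by apply: sumr_ge0 => i _; rewrite mulr_ge0// addr_ge0.
have dq (h : R) : `|h - t| < t / 2 -> density L (M * B) (fun y => E y * q h y).
  move=> h1; have h2 := ht h h1; apply: density_mul => //.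
    apply: measurable_funM => //.
    apply: measurable_sum => i.
    apply: measurable_funM; first exact: measurable_coordB.
    exact: (measurable_pt_comp h x (@cdp i)).
  move=> y cy; rewrite /q normrM ler_pM//.
    have hp := lt_trans e0 h2.
    rewrite normrN ger0_norm ?invr_ge0 ?exprn_ge0 ?(ltW hp)//.
    by rewrite lef_pV2 ?posrE ?exprn_gt0// ler_pXn2r ?nnegrE ?ltW.
  rewrite (le_trans (ler_norm_sum _ _ _))// ler_sum// => i _.
  rewrite normrM ler_pM//; first exact: coordB_le.
  by have [_ h3 _] := bdp i.
have dd (h : R) (y : rV) : `|h - t| < t / 2 -> setT y ->
    is_derive h 1 (fun h => E y * psi (pt h x y)) (E y * q h y).
  move=> h1 _; have h2 := ht h h1.
  have h0 : h != 0 by rewrite gt_eqF// (lt_trans e0).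
  (* [pt h x y] is affine in [h^-1], so the derivative along a line is composed with inversion. *)
  have H1 := is_derive_bump_line y (x - y) h^-1.
  have H2 : is_derive h 1 (fun h : R => h^-1) (- h ^- 2).
    apply: DeriveDef.
      by apply: derivableV => //; exact: derivable_id.
    by rewrite deriveV// derive_id [LHS]mulr1.
  have H3 : is_derive h 1 (fun h => psi (pt h x y)) (q h y).
    have [dH1 vH1] := H1; have [dH2 vH2] := H2.
    apply: DeriveDef.
      apply/derivable1_diffP.
      apply: (@differentiable_comp _ _ _ _ (fun h : R => h^-1) (fun s : R => psi (y + s *: (x - y)))).
        exact/derivable1_diffP.
      exact/derivable1_diffP.
    rewrite -derive1E (@derive1_comp _ (fun h : R => h^-1) (fun s : R => psi (y + s *: (x - y))))//.
    by rewrite !derive1E vH1 vH2 mulrC.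
  apply: (is_derive_eq (is_deriveM (is_derive_cst (E y) h 1) H3)).
  by rewrite /GRing.scale /=; ring.
have H := is_derive_Rintegral measurableT e0
  (fun h h1 => density_integrable (density_I0 dE bp h x)) dd
  (integrable_scaled_cube L (M * B)) (fun h y h1 _ => density_le_cube y (dq h h1)).
apply: (is_derive_eq H).
have iB i := density_integrable (density_I1 L0 dE (bdp i) i t (lexx `|x|)).
rewrite -Rintegral_sum// -RintegralZl//; last exact: integrable_Rsum.
by apply: eq_Rintegral => y _; rewrite /q mulrCA mulr_sumr.
Qed.

End transform_derivatives.

(** * Bounds on the moments by powers of [t] *)

Section transform_bounds.
Context {R : realType} {n : nat}.
Notation rV := 'rV[R]_n.
Notation mu := (@rvmeas R n).

Definition cball (Z : R) : set rV := [set z | `|z| <= Z].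

Lemma measurable_cball Z : measurable (cball Z).
Proof.
rewrite -[cball Z]setCK; apply: measurableC; apply: open_measurable_row.
have -> : ~` cball Z = [set z | Z < `|z|].
  by apply/seteqP; split => z /=; rewrite ltNge => /negP.
by apply: (@open_comp _ _ (fun z : rV => `|z|) [set s | Z < s]) => [z _|];
  [exact: norm_continuous|exact: open_gt].
Qed.

Lemma cball_finite Z : (mu (cball Z) < +oo)%E.
Proof.
apply: le_lt_trans (cube_finite_rvmeas (Z + 1)).
apply: le_measure; rewrite ?inE; [exact: measurable_cball|exact: measurable_cube|].
by move=> z /= zZ; apply: cubeP; rewrite (le_lt_trans zZ)// ltrDl.
Qed.

Lemma integrable_cball Z : mu.-integrable setT (EFin \o \1_(cball Z)).
Proof.
apply/integrableP; split.
  by apply/measurable_EFinP; apply: measurable_indic; exact: measurable_cball.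
rewrite (eq_integral (fun x => (\1_(cball Z) x)%:E)); last first.
  by move=> t _; rewrite gee0_abs// lee_fin.
by rewrite integral_indic ?setIT//; [exact: cball_finite|exact: measurable_cball].
Qed.

Definition vol (Z : R) : R := fine (mu (cball Z)).

Lemma vol_ge0 Z : 0 <= vol Z. Proof. exact: fine_ge0. Qed.

(** For fixed [t] and [x], the set of [y] with [pt t x y] in the ball has measure [(t / (1 - t))^n]
    times that of the ball: this is the gain of [t^n]. *)
Lemma Rintegral_pt_bound (t B Z : R) (x : rV) (f : rV -> R) : 0 < t < 1 ->
  measurable_fun setT f -> 0 <= B ->
  (forall y, `|f y| <= B * \1_(cball Z) (pt t x y)) ->
  `|\int[mu]_y f y| <= B * ((t / (1 - t)) ^+ n * vol Z).
Proof.
move=> t01 mf B0 fB; have /andP[t0 t1] := t01.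
have ic : mu.-integrable setT (EFin \o (fun y => \1_(cball Z) (pt t x y) : R)).
  apply: (@integrable_pt _ _ t x (\1_(cball Z))); rewrite ?(gt_eqF t0) ?(lt_eqF t1)//.
  exact: integrable_cball.
have iB : mu.-integrable setT (EFin \o (fun y => B * \1_(cball Z) (pt t x y))).
  rewrite (_ : EFin \o _ = (fun y => B%:E * (\1_(cball Z) (pt t x y))%:E)%E)//.
  exact: integrableZl.
have fi : mu.-integrable setT (EFin \o f).
  apply: (le_integrable measurableT _ _ iB); first exact/measurable_EFinP.
  by move=> y _; rewrite lee_fin (le_trans (fB y))// ler_norm.
apply: (le_trans (le_normr_Rintegral measurableT fi)).
have -> : B * ((t / (1 - t)) ^+ n * vol Z) =
    \int[mu]_y (B * \1_(cball Z) (pt t x y)).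
  rewrite RintegralZl//; congr (_ * _).
  rewrite Rintegral_pt//; last exact: integrable_cball.
  congr (_ * _); rewrite /Rintegral integral_indic ?setIT//.
  exact: measurable_cball.
by apply: le_Rintegral => //; exact: (integrable_norm fi).
Qed.

Section bounds.
Variables (L M Z C eta t : R) (x : rV) (E chi : rV -> R).
Hypotheses (Z0 : 0 <= Z) (dE : density L M E) (bchi : bump_fun Z C chi).
Hypotheses (t01 : 0 < t < 1) (eta0 : 0 <= eta).
Hypothesis Eeta : forall y, `|pt t x y| <= Z -> `|E y| <= eta.

Lemma I0_bound : `|I0 E chi t x| <= eta * C * ((t / (1 - t)) ^+ n * vol Z).
Proof.
have [cc bc sc] := bchi; have C0 := bump_C_ge0 bchi; have [mE _ _] := dE.
apply: (@Rintegral_pt_bound _ _ _ x) => //.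
- by apply: measurable_funM => //; exact: measurable_pt_comp.
- by rewrite mulr_ge0.
- move=> y; have [h|h] := lerP `|pt t x y| Z.
    by rewrite indicE mem_set// mulr1 normrM ler_pM// Eeta.
  by rewrite sc// mulr0 normr0 !mulr_ge0.
Qed.

(** [pt_subE] supplies one more factor [t / (1 - t)] than in [I0_bound]. As [Eeta] constrains [E]
    only where the kernel can be nonzero, [eta] may measure the smallness of the density near
    [x]. *)
Lemma I1_bound i : `|I1 E chi i t x| <=
  eta * ((t / (1 - t)) * (Z + `|x|) * C) * ((t / (1 - t)) ^+ n * vol Z).
Proof.
have [cc bc sc] := bchi; have C0 := bump_C_ge0 bchi; have [mE _ _] := dE.
have /andP[t0 t1] := t01.
have s0 : 0 < t / (1 - t) by rewrite divr_gt0// subr_gt0.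
have S0 : 0 <= t / (1 - t) * (Z + `|x|) * C.
  by apply: mulr_ge0 => //; apply: mulr_ge0; [exact: ltW|exact: addr_ge0].
apply: (@Rintegral_pt_bound _ _ _ x) => //.
- apply: measurable_funM => //; apply: measurable_funM; first exact: measurable_coordB.
  exact: measurable_pt_comp.
- exact: mulr_ge0.
- move=> y; have [h|h] := lerP `|pt t x y| Z.
    rewrite indicE mem_set// mulr1 normrM ler_pM ?Eeta//.
    rewrite normrM ler_pM//.
    rewrite (le_trans (row_coord_le _ _))// (pt_subE _ _ t01) normrZ gtr0_norm//.
    by rewrite ler_pM2l// (le_trans (ler_normB _ _))// lerD2r.
  by rewrite sc// !mulr0 normr0; apply: mulr_ge0 => //; exact: mulr_ge0.
Qed.

End bounds.

End transform_bounds.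

(** * Exact evaluation of the moments of a constant density *)

Section cancellation.
Context {R : realType} {n : nat}.
Notation rV := 'rV[R]_n.
Notation mu := (@rvmeas R n).
Implicit Types (x y z : rV) (chi psi : rV -> R).

Lemma density_cube (K : R) : density K 1 (\1_(@cube R n K) : rV -> R).
Proof.
split; first by apply: measurable_indic; exact: measurable_cube.
- by move=> y; rewrite indicE; case: (_ \in _); rewrite /= ?normr1 ?normr0.
- by move=> y cy; rewrite indicE memNset.
Qed.

Lemma density_bump_fun Z C chi : bump_fun Z C chi -> density (Z + 1) C chi.
Proof.
move=> [cc bc sc]; split => //; first exact: continuous_measurable_row.
move=> y cy; apply: contrapT => cy0; apply: cy; apply: cubeP.
rewrite ltNge; apply/negP => Zy; apply: cy0; apply: sc.
by apply: lt_le_trans Zy; rewrite ltrDl.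
Qed.

Lemma bump_integrable Z C chi : bump_fun Z C chi -> mu.-integrable setT (EFin \o chi).
Proof. by move=> /density_bump_fun; exact: density_integrable. Qed.

Lemma bump_coord_integrable Z C chi i : 0 <= Z -> bump_fun Z C chi ->
  mu.-integrable setT (EFin \o (fun z => chi z * z 0 i)).
Proof.
move=> Z0 bc; have C0 := bump_C_ge0 bc.
apply: (@density_integrable _ _ (Z + 1) (C * (Z + 1))).
apply: density_mul => //; first exact: density_bump_fun.
- exact: coord_measurable.
- by rewrite addr_ge0.
- by move=> y cy; rewrite ltW.
Qed.

Lemma cube_of_pt (K Z t : R) x y : 0 < t < 1 ->
  `|x| + t / (1 - t) * (Z + `|x|) < K -> `|pt t x y| <= Z -> cube K y.
Proof.
move=> t01 xK pZ; apply: cubeP; apply: le_lt_trans xK.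
have /andP[t0 t1] := t01.
have s0 : 0 < t / (1 - t) by rewrite divr_gt0// subr_gt0.
rewrite -[y](subKr x) (le_trans (ler_normB _ _))// lerD2l (pt_subE _ _ t01) normrZ.
by rewrite gtr0_norm// ler_pM2l// (le_trans (ler_normB _ _))// lerD2r.
Qed.

(** The indicator of a large cube stands for the constant [1], which has no bounded support. By
    [cube_of_pt], the bound on [K] puts every [y] seen by the kernel inside the cube. *)
Lemma I0_cube (K Z C t : R) x chi : 0 < t < 1 -> bump_fun Z C chi ->
  `|x| + t / (1 - t) * (Z + `|x|) < K ->
  I0 (\1_(@cube R n K)) chi t x = (t / (1 - t)) ^+ n * \int[mu]_z chi z.
Proof.
move=> t01 bc xK; have [_ _ sc] := bc.
rewrite -(Rintegral_pt x t01 (bump_integrable bc)).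
apply: eq_Rintegral => y _; have [h|h] := lerP `|pt t x y| Z.
  by rewrite indicE mem_set ?mul1r//; exact: cube_of_pt h.
by rewrite sc// mulr0.
Qed.

(** By [pt_subE] the factor [(x - y)_i] is a function of [pt t x y] as well, so the whole integrand
    is, and the change of variables evaluates the integral. *)
Lemma I1_cube (K Z C t : R) x chi i : 0 <= Z -> 0 < t < 1 -> bump_fun Z C chi ->
  `|x| + t / (1 - t) * (Z + `|x|) < K ->
  I1 (\1_(@cube R n K)) chi i t x = (t / (1 - t)) ^+ n.+1 *
    (\int[mu]_z (chi z * z 0 i) - x 0 i * \int[mu]_z chi z).
Proof.
move=> Z0 t01 bc xK; have [_ _ sc] := bc.
have i1 := bump_coord_integrable i Z0 bc.
have i2 := bump_integrable bc.
have i3 : mu.-integrable setT (EFin \o (fun z => x 0 i * chi z)).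
  rewrite (_ : EFin \o _ = (fun z => (x 0 i)%:E * (chi z)%:E)%E)//.
  exact: integrableZl.
have i4 : mu.-integrable setT (EFin \o (fun z => chi z * z 0 i - x 0 i * chi z)).
  rewrite (_ : EFin \o _ =
     (fun z => (chi z * z 0 i)%:E - (x 0 i * chi z)%:E)%E)//.
  exact: integrableB.
rewrite -(RintegralZl _ measurableT i2) -RintegralB// exprS -mulrA.
rewrite -(Rintegral_pt x t01 i4) -RintegralZl//; last first.
  have /andP[t0 t1] := t01.
  by apply: (@integrable_pt _ _ t x (fun z => chi z * z 0 i - x 0 i * chi z));
    rewrite ?(gt_eqF t0) ?(lt_eqF t1).
apply: eq_Rintegral => y _; have [h|h] := lerP `|pt t x y| Z; last first.
  by rewrite sc// !mulr0 mul0r subrr mulr0.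
rewrite indicE mem_set ?mul1r; last exact: cube_of_pt h.
have -> : (x - y) 0 i = t / (1 - t) * (pt t x y 0 i - x 0 i).
  by rewrite (pt_subE _ _ t01) !mxE.
by ring.
Qed.

(* Near [x] the kernel integrated against a constant is the affine function
   [(t / (1 - t)) ^+ n.+1 * (m - x 0 i)], whose derivative is read off. *)
Lemma cancellation (K Z C t : R) x psi i j : 0 <= Z -> 0 < t < 1 ->
  bump1 Z C psi -> \int[mu]_z psi z = 1 ->
  `|x| + t / (1 - t) * (Z + `|x|) < K ->
  (i == j)%:R * I0 (\1_(@cube R n K)) psi t x
    + t^-1 * I1 (\1_(@cube R n K)) ('D_(ebase R j) psi) i t x =
  - (i == j)%:R * (t / (1 - t)) ^+ n.+1.
Proof.
move=> Z0 t01 bp psi1 xK; have [bpsi _ _] := bp.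
have /andP[t0 t1] := t01.
have s0 : 0 < t / (1 - t) by rewrite divr_gt0// subr_gt0.
have K0 : 0 <= K.
  by apply: ltW; apply: le_lt_trans xK; rewrite addr_ge0// mulr_ge0 ?(ltW s0)// addr_ge0.
have D1 := is_derive_I1 K0 (density_cube K) bp i j t x.
pose m := \int[mu]_z (psi z * z 0 i).
have D2 : is_derive x (ebase R j)
    (fun z : rV => (t / (1 - t)) ^+ n.+1 * (m - z 0 i))
    (- (i == j)%:R * (t / (1 - t)) ^+ n.+1).
  apply: is_derive_line0.
  rewrite (_ : (fun h => _) = (fun h : R => (t / (1 - t)) ^+ n.+1 * (m - x 0 i) +
      h *: ((- (i == j)%:R * (t / (1 - t)) ^+ n.+1) : R))).
    exact: is_derive_affine.
  apply/funext => h; rewrite !mxE /= /GRing.scale /=; ring.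
have E : \near x, I1 (\1_(@cube R n K)) psi i t x =
    (t / (1 - t)) ^+ n.+1 * (m - x 0 i).
  have cn : (fun z : rV => `|z|) @ nbhs x --> `|x| by exact: norm_continuous.
  have cK : (fun z : rV => `|z| + t / (1 - t) * (Z + `|z|)) @ nbhs x -->
      `|x| + t / (1 - t) * (Z + `|x|).
    apply: cvgD; first exact: cn.
    apply: cvgM; first exact: cvg_cst.
    by apply: cvgD; [exact: cvg_cst|exact: cn].
  near=> z.
  rewrite (@I1_cube _ Z C)// ?psi1 ?mulr1//.
  by near: z; exact: (cvgr_lt _ cK K xK).
have [_ <-] := D1; have [_ <-] := D2.
exact: near_eq_derive.
Unshelve. all: by end_near. Qed.

End cancellation.

(** * The kernels [g_i], their derivatives and [A]: derivatives and bounds *)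

Section kernels.
Context {R : realType} {n : nat}.
Notation rV := 'rV[R]_n.
Notation mu := (@rvmeas R n).
Implicit Types (t : R) (x y z : rV).

(* [gk], [dgk] and [Ak] are [g_i], [D_j g_i] and [A] of the header. *)
Definition gk (E psi : rV -> R) i t x := t ^- n.+1 * I1 E psi i t x.
Definition dgk (E psi : rV -> R) i j t x :=
  t ^- n.+1 * ((i == j)%:R * I0 E psi t x
               + t^-1 * I1 E ('D_(ebase R j) psi) i t x).
Definition Ak (E psi : rV -> R) t x := t ^- n * I0 E psi t x.

Variables (L M Z C : R) (E psi : rV -> R).
Hypotheses (L0 : 0 <= L) (dE : density L M E) (Z0 : 0 <= Z).
Hypotheses (bpsi : bump1 Z C psi) (psi1 : \int[mu]_z psi z = 1).
Let M0 : 0 <= M := density_M_ge0 dE.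
Let bp : bump_fun Z C psi. Proof. by have [] := bpsi. Qed.
Let bdp i : bump_fun Z C ('D_(ebase R i) psi). Proof. by have [] := bpsi. Qed.
Let C0 : 0 <= C := bump_C_ge0 bp.

Lemma is_derive_gk i j t x :
  is_derive x (ebase R j) (gk E psi i t) (dgk E psi i j t x).
Proof.
have D1 := is_derive_I1 L0 dE bpsi i j t x.
apply: (is_derive_eq (is_deriveZ (t ^- n.+1) D1)).
by rewrite /dgk.
Qed.

Lemma cvg_invX m t x : t != 0 ->
  (fun p : R * rV => p.1 ^- m) @ nbhs (t, x) --> t ^- m.
Proof.
move=> t0; apply: cvgV; first by rewrite expf_neq0.
apply: (@cvg_comp _ _ _ (fun p : R * rV => p.1) (fun s : R => s ^+ m) _ (nbhs t)).
  exact: cvg_fst.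
exact: exprn_continuous.
Qed.

Lemma cvg_gk i t x : t != 0 ->
  (fun p : R * rV => gk E psi i p.1 p.2) @ nbhs (t, x) --> gk E psi i t x.
Proof.
move=> t0; apply: cvgM; last exact: (cvg_I1 L0 dE bp).
exact: cvg_invX.
Qed.

Lemma cvg_dgk i j t x : t != 0 ->
  (fun p : R * rV => dgk E psi i j p.1 p.2) @ nbhs (t, x) --> dgk E psi i j t x.
Proof.
move=> t0.
have h : (fun p : R * rV => p.1) @ nbhs (t, x) --> t by exact: cvg_fst.
apply: cvgM.
  exact: cvg_invX.
apply: cvgD.
  by apply: cvgM; [exact: cvg_cst|exact: (cvg_I0 dE bp)].
apply: cvgM; first by apply: cvgV.
exact: (cvg_I1 L0 dE (bdp j)).
Qed.

Lemma is_derive_invX m t : t != 0 ->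
  is_derive t 1 (fun s : R => s ^- m) (- m%:R * t ^- m.+1).
Proof.
move=> t0; have tm0 : t ^+ m != 0 by rewrite expf_neq0.
have dX := @exprn_derivable R m t 1.
apply: DeriveDef; first exact: derivableV.
rewrite deriveV// exp_derive /GRing.scale /= mulr1.
case: m tm0 {dX} => [|k] tk0; first by rewrite oppr0 !mul0r mulr0.
by rewrite /= !exprS; field; rewrite t0 expf_neq0.
Qed.

(** Differentiating [t^-n] yields [-n t^-(n+1) I0]; the Kronecker terms of the diagonal [dgk] sum to
    the same multiple [n]. The [I1] terms agree by [is_derive_I0]. *)
Lemma is_derive_Ak t x : 0 < t ->
  is_derive t 1 (fun s => Ak E psi s x) (- \sum_(i < n) dgk E psi i i t x).
Proof.
move=> t0; have D1 := is_derive_I0 L0 dE bpsi x t0.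
have t0' : t != 0 by rewrite gt_eqF.
have D2 := is_derive_invX n t0'.
apply: (is_derive_eq (is_deriveM D2 D1)).
rewrite /GRing.scale /=.
have -> : \sum_(i < n) dgk E psi i i t x = t ^- n.+1 *
   (n%:R * I0 E psi t x + t^-1 * \sum_(i < n) I1 E ('D_(ebase R i) psi) i t x).
  rewrite -mulr_sumr big_split /= -mulr_sumr; congr (_ * (_ + _)).
  under eq_bigr do rewrite eqxx mul1r.
  by rewrite sumr_const card_ord mulr_natl.
by rewrite !exprS; field; rewrite expf_neq0 gt_eqF.
Qed.

Lemma Ak1 x : Ak E psi 1 x = psi x * \int[mu]_y E y.
Proof.
rewrite /Ak expr1n invr1 mul1r /I0 -RintegralZl//; last exact: density_integrable dE.
by apply: eq_Rintegral => y _; rewrite /pt invr1 scale1r addrCA subrr addr0 mulrC.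
Qed.

Lemma inv1m_bounds t : 0 < t <= 1 / 2 -> 0 < (1 - t)^-1 <= 2.
Proof.
move=> /andP[t0 t1]; have h : 0 < 1 - t by lra.
by rewrite invr_gt0 h /= -[leRHS]invrK lef_pV2 ?posrE ?invr_gt0//; lra.
Qed.

Lemma inv1m_X t m : 0 < t <= 1 / 2 -> 0 <= (1 - t)^-1 ^+ m <= 2 ^+ m.
Proof.
move=> /inv1m_bounds/andP[s0 s2].
apply/andP; split; first by rewrite exprn_ge0// ltW.
by rewrite lerXn2r ?nnegrE ?(ltW s0)// (le_trans (ltW s0)).
Qed.

(** Up to [t = 1/2] the powers of [t] cancel in [I1_bound]; beyond, where [1 - t] may vanish,
    [t^-(n+1) <= 2^(n+1)] and the support of the density suffice. The bound is uniform over
    densities with the same [L] and [M], because it is later applied to a density modified by signs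
    depending on [t]. *)
Lemma gk_bound i (r : R) : 0 <= r -> exists2 B, 0 <= B &
  forall E', density L M E' -> forall t x, 0 < t <= 1 -> `|x| <= r ->
  `|gk E' psi i t x| <= B.
Proof.
move=> r0.
pose B1 := M * ((Z + r) * C) * @vol R n Z * 2 ^+ n.+1 : R.
pose B2 := 2 ^+ n.+1 * (M * ((r + L) * C) * fine (mu (@cube R n L))) : R.
have B10 : 0 <= B1.
  by rewrite /B1 !mulr_ge0 ?vol_ge0 ?exprn_ge0// addr_ge0.
have B20 : 0 <= B2.
  by rewrite /B2 !mulr_ge0 ?exprn_ge0 ?fine_ge0// addr_ge0.
exists (B1 + B2) => [|E' dE' t x]; first exact: addr_ge0.
move=> /andP[t0 t1] xr.
have [t2|t2] := leP t (1 / 2).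
  have t01 : 0 < t < 1 by rewrite t0/=; lra.
  have t02 : 0 < t <= 1 / 2 by rewrite t0.
  have h := I1_bound (x := x) Z0 dE' bp t01 M0 (fun y _ => let: And3 _ b _ := dE' in b y) i.
  rewrite /gk normrM normfV normrX (gtr0_norm t0).
  have /andP[s0 s1] := inv1m_X n.+1 t02.
  have -> : B1 + B2 = (t ^+ n.+1)^-1 * (t ^+ n.+1 * (B1 + B2)).
    by rewrite mulrA mulVf ?mul1r// expf_neq0// gt_eqF.
  rewrite ler_pM2l ?invr_gt0 ?exprn_gt0//; apply: (le_trans h).
  have -> : M * (t / (1 - t) * (Z + `|x|) * C) * ((t / (1 - t)) ^+ n * @vol R n Z) =
     t ^+ n.+1 * (M * ((Z + `|x|) * C) * @vol R n Z * (1 - t)^-1 ^+ n.+1).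
    by rewrite !exprMn !exprS; ring.
  rewrite ler_pM2l ?exprn_gt0// (le_trans _ (_ : B1 <= _)) ?lerDl//.
  rewrite /B1 ler_pM ?mulr_ge0 ?vol_ge0 ?addr_ge0//.
  by rewrite ler_wpM2r ?vol_ge0// ler_wpM2l// ler_wpM2r// lerD2l.
have h := le_Rintegral_density (density_I1 L0 dE' bp i t xr).
rewrite /gk normrM (le_trans _ (_ : B2 <= _)) ?lerDr//.
rewrite /B2 ler_pM//; last by apply: h; rewrite !mulr_ge0// addr_ge0.
rewrite normfV normrX (gtr0_norm t0) -exprVn lerXn2r ?nnegrE ?invr_ge0 ?(ltW t0)//.
by rewrite -[leRHS]invrK lef_pV2 ?posrE ?invr_gt0//; lra.
Qed.

Lemma dgk_bound i j (r t0 : R) : 0 <= r -> 0 < t0 -> exists B, forall t x,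
  t0 <= t -> `|x| <= r -> `|dgk E psi i j t x| <= B.
Proof.
move=> r0 t00.
pose m := fine (mu (@cube R n L)).
have m0 : 0 <= m by exact: fine_ge0.
exists (t0^-1 ^+ n.+1 * (M * C * m + t0^-1 * (M * ((r + L) * C) * m))) => t x tt xr.
have tp : 0 < t by exact: lt_le_trans tt.
have tV : t^-1 <= t0^-1 by rewrite lef_pV2.
rewrite /dgk normrM -exprVn normrX normfV (gtr0_norm tp) ler_pM//.
  by rewrite exprn_ge0// invr_ge0 ltW.
  by rewrite lerXn2r ?nnegrE ?invr_ge0 ?(ltW tp) ?(ltW t00).
rewrite (le_trans (ler_normD _ _))// lerD//.
  rewrite normrM (_ : M * C * m = 1 * (M * C * m)); last by rewrite mul1r.
  rewrite ler_pM//; first by case: (i == j); rewrite ?normr1 ?normr0.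
  by apply: (le_Rintegral_density (density_I0 dE bp t x)); exact: mulr_ge0.
rewrite normrM normfV (gtr0_norm tp) ler_pM ?invr_ge0 ?(ltW tp)//.
apply: (le_Rintegral_density (density_I1 L0 dE (bdp j) i t xr)).
by rewrite !mulr_ge0// addr_ge0.
Qed.

Section near_zero.
Variables (r : R) (r0 : 0 <= r).
(** [K] is at least [L], and exceeds [|x| + t / (1 - t) (Z + |x|)] when [|x| <= r] and [t <= 1/2],
    where [t / (1 - t) <= 1]. In [W], [2^n] bounds [(1 - t)^-n]; the summands [1] and [2 (Z + r)]
    come from the [I0] and the [I1] term of [dgk]. *)
Let K := L + r + (Z + r) + 1.
Let W := 2 ^+ n * @vol R n Z * C * (1 + 2 * (Z + r)).

Let W0 : 0 <= W.
Proof.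
by rewrite /W !mulr_ge0 ?exprn_ge0 ?vol_ge0// addr_ge0// mulr_ge0// addr_ge0.
Qed.

(** [E] is split as [E'] plus [E x] times the indicator of a cube. On the support of the kernel [E']
    is at most [eta], which gives the terms in [W]; the constant part is evaluated exactly and gives
    the remaining ones. *)
Lemma near_zero_bounds t x (eta : R) : 0 < t <= 1 / 2 -> `|x| <= r -> 0 <= eta ->
  (forall y, `|y - x| <= 2 * t * (Z + r) -> `|E y - E x| <= eta) ->
  (forall i j, `|dgk E psi i j t x| <= W * (eta / t) + M * 2 ^+ n.+1) /\
  `|Ak E psi t x - E x * (1 - t)^-1 ^+ n| <= W * eta.
Proof.
move=> t02 xr eta0 hE; have /andP[t0 t2] := t02.
have t01 : 0 < t < 1 by rewrite t0/=; lra.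
have s0 : 0 < 1 - t by lra.
have /andP[sp s2] := inv1m_bounds t02.
(* Since [1 - t >= 1/2], every [y] seen by the kernel is within [2 t (Z + r)] of [x], the range
   covered by [hE]. *)
have sx : t / (1 - t) * (Z + `|x|) <= 2 * t * (Z + r).
  rewrite (_ : 2 * t * (Z + r) = t * (2 * (Z + r))); last by ring.
  rewrite -mulrA ler_pM2l//; apply: ler_pM => //; first exact: ltW.
    by rewrite addr_ge0.
  by rewrite lerD2l.
have xK : `|x| + t / (1 - t) * (Z + `|x|) < K.
  have hA : t / (1 - t) * (Z + `|x|) <= 1 * (Z + r).
    rewrite ler_pM// ?addr_ge0// ?lerD2l//; first by rewrite divr_ge0// ltW.
    by rewrite ler_pdivrMr//; lra.
  by apply: (le_lt_trans (lerD xr hA)); rewrite /K mul1r -!addrA ltr_wpDl// !ltrD2l ltrDl.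
have LK : L <= K by rewrite /K -!addrA lerDl !addr_ge0.
have K0 : 0 <= K by exact: le_trans LK.
have cLK (y : rV) : cube L y -> cube K y.
  by move=> cy i; exact: lt_le_trans (cy i) LK.
pose c := E x.
pose E' y := E y - c * \1_(@cube R n K) y.
have [mE bE sE0] := dE.
have dEK : density K M E.
  by split => // y cy; apply: sE0 => /cLK.
have dE' : density K (M + `|c|) E'.
  split.
  - apply: measurable_funB => //; apply: measurable_funM => //.
    by apply: measurable_indic; exact: measurable_cube.
  - move=> y; rewrite (le_trans (ler_normB _ _))// lerD// normrM.
    by rewrite -[leRHS]mulr1 ler_wpM2l//; have [_ h1 _] := @density_cube R n K; exact: h1.
  - move=> y cy; rewrite /E' indicE memNset// mulr0 subr0; apply: sE0.
    by move=> /cLK.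
have E'eta y : `|pt t x y| <= Z -> `|E' y| <= eta.
  move=> pZ; rewrite /E' indicE mem_set ?mulr1; last exact: cube_of_pt pZ.
  apply: hE; rewrite distrC (pt_subE _ _ t01) normrZ gtr0_norm ?divr_gt0//.
  apply: le_trans sx; rewrite ler_pM2l ?divr_gt0//.
  by rewrite (le_trans (ler_normB _ _))// lerD2r.
have EE : E = (fun y => E' y + c * \1_(@cube R n K) y).
  by apply/funext => y; rewrite /E' subrK.
have lin0 chi : bump_fun Z C chi ->
    I0 E chi t x = I0 E' chi t x + c * I0 (\1_(@cube R n K)) chi t x.
  move=> bc.
  have i1 := density_integrable (density_I0 dE' bc t x).
  have i2 := density_integrable (density_I0 (density_cube K) bc t x).
  rewrite /I0 -(RintegralZl _ measurableT i2) -RintegralD//.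
    by apply: eq_Rintegral => y _; rewrite {1}EE; ring.
  rewrite (_ : EFin \o _ = (fun y => c%:E * (\1_(@cube R n K) y * chi (pt t x y))%:E)%E)//.
  exact: integrableZl.
have lin1 i chi : bump_fun Z C chi ->
    I1 E chi i t x = I1 E' chi i t x + c * I1 (\1_(@cube R n K)) chi i t x.
  move=> bc.
  have i1 := density_integrable (density_I1 K0 dE' bc i t (lexx `|x|)).
  have i2 := density_integrable (density_I1 K0 (density_cube K) bc i t (lexx `|x|)).
  rewrite /I1 -(RintegralZl _ measurableT i2) -RintegralD//.
    by apply: eq_Rintegral => y _; rewrite {1}EE; ring.
  rewrite (_ : EFin \o _ = (fun y => c%:E *
    (\1_(@cube R n K) y * ((x - y) 0 i * chi (pt t x y)))%:E)%E)//.
  exact: integrableZl.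
have b0 chi (bc : bump_fun Z C chi) := I0_bound dE' bc t01 eta0 E'eta.
have b1 i chi (bc : bump_fun Z C chi) := I1_bound Z0 dE' bc t01 eta0 E'eta i.
have /andP[sn0 sn2] := inv1m_X n t02.
have /andP[sm0 sm2] := inv1m_X n.+1 t02.
have tn0 k : t ^+ k != 0 by rewrite expf_neq0// gt_eqF.
have tk0 k : 0 < t ^+ k by rewrite exprn_gt0.
split.
- move=> i j.
  (* By [cancellation] the constant part loses its factor [1/t]; what is left is at most
     [M 2^(n+1)]. *)
  have -> : dgk E psi i j t x = dgk E' psi i j t x
      - c * ((i == j)%:R * (1 - t)^-1 ^+ n.+1).
    have := cancellation i j Z0 t01 bpsi psi1 xK.
    rewrite /dgk (lin0 _ bp) (lin1 i _ (bdp j)).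
    set a := I0 (\1_ _) _ _ _; set b := I1 (\1_ _) _ _ _ _ => ab.
    have -> : (i == j)%:R * (1 - t)^-1 ^+ n.+1 = - (t ^- n.+1 * ((i == j)%:R * a + t^-1 * b)).
      by rewrite ab exprMn; field; rewrite ?tn0 ?expf_neq0 ?(gt_eqF t0) ?(gt_eqF s0).
    ring.
  rewrite (le_trans (ler_normB _ _))// lerD//; last first.
    rewrite normrM; apply: ler_pM => //; first exact: bE.
    rewrite normrM (ger0_norm sm0) -[leRHS]mul1r; apply: ler_pM => //.
    by case: (i == j); rewrite ?normr1 ?normr0.
  rewrite /dgk normrM normfV normrX (gtr0_norm t0) ler_pdivrMl//.
  rewrite (le_trans (ler_normD _ _))//.
  have h1 : `|(i == j)%:R * I0 E' psi t x| <= eta * C * ((t / (1 - t)) ^+ n * @vol R n Z).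
    apply: le_trans (b0 _ bp); rewrite normrM -[leRHS]mul1r ler_pM//.
    by case: (i == j); rewrite ?normr1 ?normr0.
  have h2 : `|t^-1 * I1 E' ('D_(ebase R j) psi) i t x| <=
     t^-1 * (eta * (t / (1 - t) * (Z + `|x|) * C) * ((t / (1 - t)) ^+ n * @vol R n Z)).
    by rewrite normrM normfV (gtr0_norm t0) ler_pM2l ?invr_gt0//; exact: b1.
  apply: (le_trans (lerD h1 h2)).
  have -> : eta * C * ((t / (1 - t)) ^+ n * @vol R n Z) +
     t^-1 * (eta * (t / (1 - t) * (Z + `|x|) * C) * ((t / (1 - t)) ^+ n * @vol R n Z)) =
     t ^+ n.+1 * ((1 - t)^-1 ^+ n * @vol R n Z * C * (1 + (1 - t)^-1 * (Z + `|x|)) * (eta / t)).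
    by rewrite exprMn exprS; field; rewrite ?tn0 ?expf_neq0 ?(gt_eqF t0) ?(gt_eqF s0).
  rewrite ler_pM2l//; apply: ler_wpM2r; first by rewrite divr_ge0// ltW.
  rewrite /W; apply: ler_pM.
  + by rewrite !mulr_ge0 ?vol_ge0.
  + by rewrite addr_ge0// mulr_ge0 ?(ltW sp)// addr_ge0.
  + by rewrite ler_wpM2r// ler_wpM2r ?vol_ge0.
  + by rewrite lerD2l ler_pM ?(ltW sp)// ?addr_ge0// lerD2l.
- have -> : Ak E psi t x - E x * (1 - t)^-1 ^+ n = t ^- n * I0 E' psi t x.
    rewrite /Ak (lin0 _ bp) (I0_cube t01 bp xK) psi1 -/c exprMn.
    by field; rewrite ?tn0 ?expf_neq0 ?(gt_eqF t0) ?(gt_eqF s0).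
  rewrite normrM normfV normrX (gtr0_norm t0) ler_pdivrMl//.
  apply: (le_trans (b0 _ bp)).
  have -> : eta * C * ((t / (1 - t)) ^+ n * @vol R n Z) =
     t ^+ n * ((1 - t)^-1 ^+ n * @vol R n Z * C * 1 * eta).
    by rewrite exprMn; ring.
  rewrite ler_pM2l// ler_wpM2r// /W; apply: ler_pM => //.
  + by rewrite !mulr_ge0 ?vol_ge0.
  + by rewrite ler_wpM2r// ler_wpM2r ?vol_ge0.
  + by rewrite lerDl mulr_ge0// addr_ge0.
Qed.

Lemma near_zero : exists2 W, 0 <= W & forall t x (eta : R),
  0 < t <= 1 / 2 -> `|x| <= r -> 0 <= eta ->
  (forall y, `|y - x| <= 2 * t * (Z + r) -> `|E y - E x| <= eta) ->
  (forall i j, `|dgk E psi i j t x| <= W * (eta / t) + M * 2 ^+ n.+1) /\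
  `|Ak E psi t x - E x * (1 - t)^-1 ^+ n| <= W * eta.
Proof. by exists W => // t x eta; exact: near_zero_bounds. Qed.

End near_zero.

End kernels.

(** * Dini moduli of continuity *)

Section euclidean_norm.
Context {R : realType} {n : nat}.
Implicit Types x y : 'rV[R]_n.

Lemma enorm_ge0 x : 0 <= enorm x.
Proof. exact: sqrtr_ge0. Qed.

Lemma norm_le_enorm x : `|x| <= enorm x.
Proof.
apply: row_norm_le => [|i]; first exact: enorm_ge0.
rewrite -sqrtr_sqr ler_wsqrtr// (bigD1 i)//= lerDl.
by apply: sumr_ge0 => j _; exact: sqr_ge0.
Qed.

Lemma enorm_le x : enorm x <= n%:R * `|x|.
Proof.
have S0 : 0 <= \sum_(i < n) `|x 0 i| by exact: sumr_ge0.
apply: (@le_trans _ _ (\sum_(i < n) `|x 0 i|)).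
  rewrite -[leRHS]ger0_norm// -sqrtr_sqr ler_wsqrtr// expr2 mulr_suml.
  apply: ler_sum => i _; rewrite -(real_normK (num_real _)) expr2 ler_wpM2l//.
  by rewrite (bigD1 i)//= lerDl sumr_ge0.
have -> : n%:R * `|x| = \sum_(i < n) `|x| by rewrite sumr_const card_ord mulr_natl.
apply: ler_sum => i _.
exact: row_coord_le.
Qed.

Lemma enormZ (c : R) x : enorm (c *: x) = `|c| * enorm x.
Proof.
rewrite /enorm -sqrtr_sqr -sqrtrM ?sqr_ge0//; congr Num.sqrt.
by rewrite mulr_sumr; apply: eq_bigr => i _; rewrite !mxE exprMn.
Qed.

End euclidean_norm.

Section modulus.
Context {R : realType} {n : nat}.
Variables (Om : set 'rV[R]_n) (F : 'rV[R]_n -> R).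
Local Open Scope ereal_scope.

Lemma modcont_ub (rho : R) x y : Om x -> Om y -> (enorm (x - y) < rho)%R ->
  (`|F x - F y|)%:E <= modcont Om F rho.
Proof. by move=> Ox Oy h; apply: ereal_sup_ubound; exists x, y. Qed.

Lemma le_modcont (rho rho' : R) : (rho <= rho')%R ->
  modcont Om F rho <= modcont Om F rho'.
Proof.
move=> h; apply: le_ereal_sup => _ [x [y [Ox Oy xy ->]]].
by exists x, y; split => //; exact: lt_le_trans h.
Qed.

Lemma modcont_ge0 (rho : R) x : Om x -> (0 < rho)%R -> 0 <= modcont Om F rho.
Proof.
move=> Ox r0; apply: (le_trans _ (modcont_ub Ox Ox _)).
  by rewrite lee_fin.
have -> : (x - x)%R = 0%R *: x by rewrite subrr scale0r.
by rewrite enormZ normr0 mul0r.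
Qed.

Lemma nondecreasing_emeasurable (f : R -> \bar R) :
  {homo f : x y / (x <= y)%R >-> x <= y} -> measurable_fun [set: R] f.
Proof.
move=> fnd; apply: (measurability (@ErealGenCInfty.G R)) => [|/= _ [_] [r ->] <-].
  exact: ErealGenCInfty.measurableE.
rewrite setTI; apply: is_interval_measurable => s t /=.
rewrite !in_itv /= !andbT => fs ft u /andP[su ut].
by rewrite in_itv /= andbT (le_trans fs)// fnd.
Qed.

Lemma measurable_modcont : measurable_fun [set: R] (modcont Om F).
Proof. by apply: nondecreasing_emeasurable => x y; exact: le_modcont. Qed.

(* The segment is cut into [N] pieces, so that [w (N rho)] can be traded for
   [N w(rho)]; this only uses segments inside [Om]. *)
Lemma modcont_chain (rho w : R) (N : nat) x y : modcont Om F rho <= w%:E ->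
  (0 < N)%N -> (enorm (y - x) < N%:R * rho)%R ->
  (forall s : R, (0 <= s <= 1)%R -> Om ((1 - s) *: x + s *: y)%R) ->
  (`|F y - F x| <= N%:R * w)%R.
Proof.
move=> mw N0 xyN seg.
have NR0 : (0 < N%:R :> R)%R by rewrite ltr0n.
pose p (k : nat) := ((1 - k%:R / N%:R) *: x + (k%:R / N%:R) *: y)%R.
have pO k : (k <= N)%N -> Om (p k).
  move=> kN; apply: seg; rewrite divr_ge0//=.
  by rewrite ler_pdivrMr// mul1r ler_nat.
have p0 : p 0%N = x by rewrite /p mul0r subr0 scale1r scale0r addr0.
have pN : p N = y by rewrite /p divff ?gt_eqF// subrr scale0r add0r scale1r.
have pS k : (p k.+1 - p k = N%:R^-1 *: (y - x))%R.
  apply/rowP => i; rewrite !mxE -natr1; field; by rewrite gt_eqF.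
have step k : (k < N)%N -> (`|F (p k.+1) - F (p k)| <= w)%R.
  move=> kN; rewrite -lee_fin; apply: le_trans mw; apply: modcont_ub.
  - exact: pO.
  - by apply: pO; exact: ltnW.
  - by rewrite pS enormZ gtr0_norm ?invr_gt0// ltr_pdivrMl.
have -> : (F y - F x = \sum_(0 <= k < N) (F (p k.+1) - F (p k)))%R.
  by rewrite telescope_sumr// p0 pN.
rewrite big_mkord (le_trans (ler_norm_sum _ _ _))//.
have -> : (N%:R * w = \sum_(k < N) w)%R by rewrite sumr_const card_ord mulr_natl.
apply: ler_sum => k _.
exact: step.
Qed.

End modulus.

Section vanishing_integral.
Context {R : realType}.
Notation leb := (@lebesgue_measure R).

Lemma measurable_inv_gt0 (D : set R) : measurable D -> D `<=` `]0, +oo[%classic ->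
  measurable_fun D (@GRing.inv R).
Proof.
move=> mD D0; apply: (measurable_funS _ D0) => //.
apply: open_continuous_measurable_fun; first exact: interval_open.
move=> s; rewrite inE /= in_itv /= andbT => s0.
by apply: inv_continuous; rewrite gt_eqF.
Qed.

(** Dominated convergence for the truncations [f b], with dominating function [|g|]: at a given
    [s > 0], [f b s] vanishes as soon as [b < s]. *)
Lemma Rintegral_near0 (g : R -> R) (dl e : R) : 0 < dl -> 0 < e ->
  leb.-integrable `]0, dl]%classic (EFin \o g) ->
  exists2 a, 0 < a <= dl &
    forall b, 0 < b <= a -> `|\int[leb]_(s in `]0, b]) g s| < e.
Proof.
move=> dl0 e0 ig.
pose f (b s : R) := if (0 < b) && (s <= b) then g s else 0.
have mg : measurable_fun `]0, dl]%classic g.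
  by have /integrableP[/measurable_EFinP] := ig.
have fE b : 0 < b <= dl ->
    \int[leb]_(s in `]0, dl]) f b s = \int[leb]_(s in `]0, b]) g s.
  move=> /andP[b0 bd].
  rewrite [RHS]Rintegral_mkcond [LHS]Rintegral_mkcond.
  apply: eq_Rintegral => s _; rewrite !patchE /f b0 /=.
  have [sb|sb] := boolP (s \in `]0, b]%classic).
    move: (sb); rewrite inE /= in_itv /= => /andP[s0 ->].
    by rewrite mem_set//= in_itv /= s0 (le_trans _ bd)//; move: sb;
      rewrite inE /= in_itv /= => /andP[].
  case: ifP => //; rewrite inE /= in_itv /= => /andP[s0 _].
  case: ifP => // sb'; move: sb; rewrite notin_setE /= in_itv /= s0 sb'.
  by move=> /(_ isT).
have mf b : measurable_fun `]0, dl]%classic (f b).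
  apply: measurable_fun_if => //.
  - apply: measurable_and => //; exact: measurable_fun_ler.
  - by apply: measurable_funS mg => //; exact: subIsetl.
have c0 : (fun b => \int[leb]_(s in `]0, dl]) f b s) @ nbhs (0 : R) --> (0 : R).
  have E0 : \int[leb]_(s in `]0, dl]) f 0 s = 0.
    under eq_Rintegral => s _ do rewrite /f ltxx.
    by rewrite /Rintegral integral0.
  suff : (fun b => \int[leb]_(s in `]0, dl]) f b s) @ nbhs (0 : R) -->
      \int[leb]_(s in `]0, dl]) f 0 s by rewrite E0.
  apply: (@cvg_Rintegral_dominated R _ _ leb _ _ R (0 : R) f (fun s => `|g s|)) => //=.
  - exact: (integrable_norm ig).
  - near=> b; split.
      apply: le_integrable ig => //; first (by apply/measurable_EFinP; exact: mf).
      by move=> s _; rewrite /= lee_fin /f; case: ifP => // _; rewrite normr0.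
    by move=> s _; rewrite /f; case: ifP => // _; rewrite normr0.
  - move=> s /=; rewrite in_itv /= => /andP[s0 _].
  rewrite (_ : f 0 s = 0); last by rewrite /f ltxx.
  apply/cvgrPdist_lt => r r0; near=> b.
  have bs : b < s by near: b; exact: lt_nbhsl.
  by rewrite /f (lt_geF bs) andbF subrr normr0.
move/cvgrPdist_lt : c0 => /(_ _ e0)/nbhs_ballP[a /= a0 ha].
exists (Num.min (a / 2) dl).
  by rewrite lt_min ge_min lexx orbT dl0 divr_gt0.
move=> b /andP[b0]; rewrite le_min => /andP[ba bd].
rewrite -fE ?b0//.
have := ha b; rewrite /ball /= sub0r normrN (gtr0_norm b0) sub0r normrN; apply.
by rewrite (le_lt_trans ba)// ltr_pdivrMr// ltr_pMr// ltr1n.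
Unshelve. all: by end_near. Qed.

End vanishing_integral.

(** * Consequences of the Dini condition: finiteness, continuity, boundedness *)

Section dini.
Context {R : realType} {n : nat}.
Variables (Om : set 'rV[R]_n) (F : 'rV[R]_n -> R) (p0 : 'rV[R]_n) (dl : R).
Notation leb := (@lebesgue_measure R).
Hypotheses (Op0 : Om p0) (dl0 : 0 < dl).
Hypothesis dini : (\int[leb]_(rho in (`]0%R, dl]%classic : set R))
   (modcont Om F rho * (rho^-1)%:E) < +oo)%E.

Lemma measurable_dini (D : set R) : measurable D -> D `<=` `]0, +oo[%classic ->
  measurable_fun D (fun rho => modcont Om F rho * (rho^-1)%:E)%E.
Proof.
move=> mD D0; apply: emeasurable_funM.
  by apply: (measurable_funS measurableT) => //; exact: measurable_modcont.
by apply/measurable_EFinP; exact: measurable_inv_gt0.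
Qed.

Lemma itvoc_gt0 (b : R) : `]0, b]%classic `<=` `]0, +oo[%classic.
Proof. by move=> s /=; rewrite !in_itv /= => /andP[->]. Qed.

(** If the modulus stayed above [e], the Dini integral would dominate that of [e / s]. But
    [e / s >= e / a] on []0, a]], so the integral of [e / s] there is at least [e] for every [a],
    against [Rintegral_near0]. *)
Lemma modcont_small (e : R) : 0 < e ->
  exists2 rho, 0 < rho <= dl & (modcont Om F rho < e%:E)%E.
Proof.
move=> e0; apply: contrapT => nx.
have me rho : 0 < rho <= dl -> (e%:E <= modcont Om F rho)%E.
  by move=> rd; rewrite leNgt; apply/negP => h; apply: nx; exists rho.
pose g (s : R) := e / s.
have mg : measurable_fun `]0, dl]%classic (EFin \o g).
  apply/measurable_EFinP; apply: measurable_funM => //.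
  by apply: measurable_inv_gt0 => //; exact: itvoc_gt0.
have ig : leb.-integrable `]0, dl]%classic (EFin \o g).
  apply/integrableP; split => //.
  apply: le_lt_trans dini; apply: ge0_le_integral => //.
  - exact: measurableT_comp.
  - by apply: measurable_dini => //; exact: itvoc_gt0.
  - move=> s /=; rewrite in_itv /= => /andP[s0 sd].
    rewrite /g ger0_norm ?divr_ge0 ?(ltW s0) ?(ltW e0)// EFinM.
    apply: lee_wpmul2r; first by rewrite lee_fin invr_ge0 ltW.
    by apply: me; rewrite s0.
have [a /andP[a0 ad] /(_ a)] := Rintegral_near0 dl0 e0 ig.
rewrite a0 lexx => /(_ isT); apply/negP; rewrite -leNgt.
have iga : leb.-integrable `]0, a]%classic (EFin \o g).
  apply: integrableS ig => //; apply: subset_itvl; by rewrite bnd_simp.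
apply: le_trans (ler_norm _).
have -> : e = \int[leb]_(s in `]0, a]) (e / a).
  rewrite Rintegral_cst//= lebesgue_measure_itv /= lte_fin a0 -EFinB /=.
  by rewrite subr0 divfK// gt_eqF.
apply: le_Rintegral => //.
  apply/integrableP; split; first exact/measurable_EFinP.
  rewrite integral_cst//; apply: lte_mul_pinfty => //.
  change (leb (`]0%R, a]%classic : set R) < +oo)%E.
  by rewrite lebesgue_measure_itv /= lte_fin a0 -EFinB ltry.
move=> s /=; rewrite in_itv /= => /andP[s0 sa].
by rewrite /g ler_pM2l// lef_pV2.
Qed.

Lemma modcont_real : exists rho0 : R, [/\ 0 < rho0 <= dl,
  (forall t : R, t <= rho0 -> (modcont Om F t <= (fine (modcont Om F t))%:E)%E) &
  leb.-integrable `]0, rho0]%classic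
    (EFin \o (fun t => fine (modcont Om F t) / t))].
Proof.
have [rho0 /andP[r0 rd] m1] := modcont_small ltr01.
have mfin t : 0 < t <= rho0 -> modcont Om F t \is a fin_num.
  move=> /andP[t0 tr]; rewrite ge0_fin_numE ?(modcont_ge0 F Op0 t0)//.
  by apply: le_lt_trans (le_modcont _ _ tr) _; rewrite (lt_trans m1)// ltry.
exists rho0; split; first by rewrite r0.
  (* For [t <= 0] the supremum runs over the empty set and is [-oo], so the inequality still holds
     although [fine] changes the value. *)
  move=> t tr; have [t0|t0] := ltP 0 t; first by rewrite fineK// mfin// t0.
  apply: (@le_trans _ _ -oo%E); last exact: leNye.
  apply: ge_ereal_sup => _ [x [y [_ _ xy ->]]].
  by have := le_lt_trans (enorm_ge0 (x - y)) xy; rewrite ltNge t0.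
have mD : measurable_fun `]0, rho0]%classic
    (EFin \o (fun t => fine (modcont Om F t) / t)).
  apply/measurable_EFinP; apply: measurable_funM.
    apply: (measurable_funS measurableT) => //.
    by apply: measurableT_comp => //; exact: measurable_modcont.
  by apply: measurable_inv_gt0 => //; exact: itvoc_gt0.
apply/integrableP; split => //.
apply: le_lt_trans dini.
apply: (@le_trans _ _ (\int[leb]_(rho in (`]0%R, rho0]%classic : set R))
   (modcont Om F rho * (rho^-1)%:E))%E).
  rewrite le_eqVlt; apply/orP; left; apply/eqP; apply: eq_integral => t.
  rewrite inE /= in_itv /= => t0r; have /andP[t0 tr] := t0r.
  have h := modcont_ge0 F Op0 t0.
  rewrite ger0_norm ?divr_ge0 ?fine_ge0 ?(ltW t0)//.
  by rewrite EFinM fineK// mfin.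
apply: ge0_subset_integral => //.
- by apply: measurable_dini => //; exact: itvoc_gt0.
- move=> t /=; rewrite in_itv /= => /andP[t0 _].
  by apply: mule_ge0; [exact: modcont_ge0 Op0 t0|rewrite lee_fin invr_ge0 ltW].
- by apply: subset_itvl; rewrite bnd_simp.
Qed.

Hypotheses (oOm : open Om) (bOm : ebounded Om) (sOm : star_shaped Om p0).
Let E (y : 'rV[R]_n) : R := (y \in Om)%:R * F y.

Lemma open_ball (a : 'rV[R]_n) : Om a ->
  exists2 e : R, 0 < e & forall x, `|x - a| < e -> Om x.
Proof.
move=> Oa; have /nbhs_ballP[e /= e0 h] : nbhs a Om by exact: open_nbhs_nbhs.
by exists e => // x xa; apply: h; rewrite -ball_normE /ball_ /= distrC.
Qed.

Lemma continuous_on_Om a : Om a -> F @ nbhs a --> F a.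
Proof.
move=> Oa; apply/cvgrPdist_lt => e e0.
have [rho /andP[r0 _] mr] := modcont_small e0.
have [d d0 hd] := open_ball Oa.
have rn0 : 0 < rho / n.+1%:R by rewrite divr_gt0.
near=> x.
have xa : `|a - x| < Num.min d (rho / n.+1%:R).
  by near: x; apply: (@cvgr_dist_lt _ _ _ (nbhs a) _ id); rewrite ?lt_min ?d0//; exact: cvg_id.
move: xa; rewrite lt_min => /andP[xd xr].
have Ox : Om x by apply: hd; rewrite distrC.
rewrite -lte_fin; apply: le_lt_trans mr; apply: modcont_ub => //.
apply: (le_lt_trans (enorm_le _)).
apply: (@le_lt_trans _ _ (n.+1%:R * `|a - x|)); first by rewrite ler_wpM2r// ler_nat.
by rewrite mulrC -ltr_pdivlMr.
Unshelve. all: by end_near. Qed.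

Lemma measurable_extension : measurable_fun setT E.
Proof.
have mO : measurable Om by exact: open_measurable_row.
rewrite (_ : E = F \_ Om); last first.
  by apply/funext => y; rewrite /E patchE; case: (y \in Om); rewrite ?mul1r ?mul0r.
apply/(measurable_restrictT F mO).
apply: (measurability (@RGenOpens.G R)) => [|/=]; first exact: RGenOpens.measurableE.
move=> _ [_ [a [b ->] <-]]; apply: open_measurable_row.
rewrite openE => x [Ox Fx]; rewrite /interior.
apply: filterI; first exact: open_nbhs_nbhs.
by apply: (continuous_on_Om Ox); apply: open_nbhs_nbhs; split.
Qed.

(** Boundedness of [F] is obtained by chaining: each [y] in [Om] is joined to [p0] by a segment
    inside [Om], of length bounded independently of [y], and a fixed number of steps with
    oscillation at most [1] covers it. *)
Lemma density_extension : exists L M : R, 0 <= L /\ density L M E.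
Proof.
have [D hD] := bOm; have [_ star] := sOm.
have [rho /andP[r0 _] mr] := modcont_small ltr01.
have mr1 := ltW mr.
have D0 : 0 <= D by apply: le_trans (hD _ Op0); exact: enorm_ge0.
(* [n (D + |p0|)] bounds the Euclidean length of the segments, [n] being the price of passing
   through the sup norm; [N] counts pieces shorter than [rho]. *)
pose N := (Num.bound (n%:R * (D + `|p0|) / rho)).+1.
have Fb y : Om y -> `|F y - F p0| <= N%:R * 1.
  move=> Oy; apply: (modcont_chain mr1) => //; last exact: star.
  apply: (le_lt_trans (enorm_le _)); rewrite -ltr_pdivrMr//.
  apply: (@le_lt_trans _ _ (n%:R * (D + `|p0|) / rho)).
    rewrite ler_pM2r ?invr_gt0// ler_wpM2l// (le_trans (ler_normB _ _))// lerD2r.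
    by apply: (le_trans (norm_le_enorm _)); exact: hD.
  rewrite (lt_le_trans (archi_boundP _)) ?ler_nat//.
  by rewrite divr_ge0 ?(ltW r0)// mulr_ge0// addr_ge0.
exists (D + 1), (`|F p0| + N%:R); split; first by rewrite addr_ge0.
split; first exact: measurable_extension.
- move=> y; rewrite /E; have [yO|yO] := boolP (y \in Om); last first.
    by rewrite mul0r normr0 addr_ge0.
  rewrite mul1r -[F y](subrK (F p0)) addrC (le_trans (ler_normD _ _))// lerD2l.
  by move: yO; rewrite inE => /Fb; rewrite mulr1.
- move=> y cy; rewrite /E memNset ?mul0r// => Oy; apply: cy; apply: cubeP.
  apply: (le_lt_trans (norm_le_enorm _)).
  by rewrite (le_lt_trans (hD _ Oy))// ltrDl.
Qed.

(** [N] depends neither on [x] nor on [t], so the oscillation at distance [t c] is controlled by the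
    very function [w(t)] whose quotient by [t] is integrable. *)
Lemma dini_local (rho0 c : R) a : 0 < rho0 -> 0 <= c ->
  (forall t : R, t <= rho0 -> (modcont Om F t <= (fine (modcont Om F t))%:E)%E) ->
  Om a -> exists (N : nat) (e t1 : R), [/\ 0 < e, 0 < t1 <= rho0 &
    forall x t y, `|x - a| < e -> 0 < t <= t1 -> `|y - x| <= t * c ->
      `|E y - E x| <= N%:R * fine (modcont Om F t)].
Proof.
move=> r0 c0 hw Oa; have [d d0 hd] := open_ball Oa.
pose N := (Num.bound (n%:R * c)).+1.
(* Half of the radius [d] is spent on [x - a] and half on [y - x], so the segment from [x] to [y]
   stays in [Om]. Dividing by [c + 1] also covers [c = 0]. *)
exists N, (d / 2), (Num.min rho0 (d / 2 / (c + 1))); split.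
- by rewrite divr_gt0.
- by rewrite lt_min ge_min lexx r0 !divr_gt0// ltr_wpDl.
move=> x t y xa /andP[t0]; rewrite le_min => /andP[tr td] yx.
have c10 : 0 < c + 1 by rewrite ltr_wpDl.
have yxd : `|y - x| <= d / 2.
  apply: (le_trans yx); apply: (@le_trans _ _ (t * (c + 1))).
    by rewrite ler_pM2l// lerDl.
  by rewrite -ler_pdivlMr.
have seg (s : R) : 0 <= s <= 1 -> Om ((1 - s) *: x + s *: y).
  move=> /andP[s0 s1]; apply: hd.
  have -> : (1 - s) *: x + s *: y - a = (x - a) + s *: (y - x).
    by apply/rowP => i; rewrite !mxE; ring.
  rewrite (splitr d) (le_lt_trans (ler_normD _ _))// ltr_leD//.
  rewrite normrZ ger0_norm// (le_trans _ yxd)//.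
  by rewrite -[leRHS]mul1r ler_wpM2r.
have Ox : Om x by have := seg 0; rewrite subr0 scale1r scale0r addr0 lexx ler01; exact.
have Oy : Om y by have := seg 1; rewrite subrr scale1r scale0r add0r lexx ler01; exact.
rewrite /E !mem_set// !mul1r; apply: (modcont_chain (hw _ tr)) => //.
apply: (le_lt_trans (enorm_le _)).
apply: (@le_lt_trans _ _ (n%:R * (t * c))); first by rewrite ler_wpM2l.
rewrite mulrCA mulrC ltr_pM2r// (lt_le_trans (archi_boundP _)) ?mulr_ge0//.
by rewrite ler_nat /N.
Qed.

End dini.

(** * From the kernel to the integral over the unit interval *)

Section smooth_bump.
Context {R : realType} {n : nat}.
Notation rV := 'rV[R]_n.

Lemma bounded_of_support (Z : R) (chi : rV -> R) : 0 <= Z -> continuous chi ->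
  (forall z, Z < `|z| -> chi z = 0) -> exists C, forall z, `|chi z| <= C.
Proof.
move=> Z0 cc sc.
have cb : compact (@cball R n Z).
  apply: bounded_closed_compact.
    exists Z; split; first exact: num_real.
    by move=> M ZM z /= zZ; rewrite (le_trans zZ)// ltW.
  rewrite (_ : cball Z = (fun z : rV => `|z|) @^-1` [set s | s <= Z])//.
  by apply: closed_comp => [z _|]; [exact: norm_continuous|exact: closed_le].
have ne : @cball R n Z !=set0 by exists 0; rewrite /cball /= normr0.
have [|c _ hc] := @EVT_max_rV R n (fun z => `|chi z|) _ ne cb.
  apply: continuous_subspaceT => z.
  exact: (continuous_comp (cc z) (@norm_continuous _ R (chi z))).
exists `|chi c| => z; have [h|h] := leP `|z| Z; first by apply: hc; rewrite inE.
by rewrite sc// normr0.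
Qed.

Lemma bump1_of_C0inf (psi : rV -> R) (p : rV) (r : R) : 0 < r -> C0inf psi ->
  fsupp psi `<=` eball p r -> exists Z C, 0 <= Z /\ bump1 Z C psi.
Proof.
move=> r0 [sm _] supp.
pose Z := `|p| + r.
have Z0 : 0 <= Z by rewrite addr_ge0// ltW.
have cpsi : continuous psi by have [] := sm [::].
have dpsi i x : derivable psi x (ebase R i) by have [_] := sm [::]; exact.
have cdpsi i : continuous ('D_(ebase R i) psi) by have [] := sm [:: i].
have spsi z : Z < `|z| -> psi z = 0.
  move=> Zz; apply: contrapT => /eqP nz.
  have : eball p r z by apply: supp; apply: subset_closure.
  rewrite /eball /= => /(le_lt_trans (norm_le_enorm _)) h.
  move: Zz; rewrite ltNge => /negP; apply.
  by rewrite /Z -[z](subrK p) addrC (le_trans (ler_normD _ _))// lerD2l ltW.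
have sdpsi i z : Z < `|z| -> 'D_(ebase R i) psi z = 0.
  move=> Zz; rewrite (@near_eq_derive _ _ _ psi (cst 0)) ?derive_cst//.
  have : \forall w \near z, Z < `|w|.
    by apply: (cvgr_gt _ (@norm_continuous _ rV z)).
  by apply: filterS => w /spsi.
have [C0 hC0] := bounded_of_support Z0 cpsi spsi.
have /choice[C hC] : forall i, exists C, forall z, `|'D_(ebase R i) psi z| <= C.
  by move=> i; apply: bounded_of_support Z0 (cdpsi i) (sdpsi i).
have CC0 i : 0 <= C i by apply: le_trans (hC i 0).
exists Z, (C0 + \sum_i C i); split => //; split.
- split => // z; apply: (le_trans (hC0 z)); rewrite lerDl.
  by apply: sumr_ge0 => i _.
- by [].
- move=> i; split => // [z|z]; last exact: sdpsi.
  apply: (le_trans (hC i z)); rewrite (bigD1 i)//= addrCA lerDl addr_ge0//.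
    by apply: le_trans (hC0 0).
  by apply: sumr_ge0 => j _.
Qed.

End smooth_bump.

Section radial_substitution.
Context {R : realType}.
Notation leb := (@lebesgue_measure R).

(** The substitution is [s = d / t]. As [Phi] vanishes beyond [T], both integrals reduce to compact
    intervals, [[d, T]] and [[d / T, 1]], which avoids the singularity at [t = 0]. *)
Lemma radial_substitution (Phi : R -> R) (d T : R) : 0 < d -> d < T ->
  continuous Phi -> (forall s, T < s -> Phi s = 0) ->
  \int[leb]_(s in `[d, +oo[) Phi s =
  \int[leb]_(t in `]0, 1]) (Phi (d / t) * (d / t ^+ 2)).
Proof.
move=> d0 dT cPhi sPhi.
have T0 : 0 < T by exact: lt_trans dT.
pose a := d / T.
have a0 : 0 < a by rewrite divr_gt0.
have a1 : a < 1 by rewrite ltr_pdivrMr// mul1r.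
pose Fd (t : R) := d / t.
have Fd1 : Fd 1 = d by rewrite /Fd divr1.
have Fda : Fd a = T by rewrite /Fd /a invf_div mulrCA divff ?mulr1// gt_eqF.
have dFd (t : R) : 0 < t -> is_derive t 1 Fd (- (d / t ^+ 2)).
  move=> t0; have t0' : t != 0 by rewrite gt_eqF.
  have D2 := is_derive_invX 1 t0'.
  apply: (is_derive_eq (is_deriveM (is_derive_cst d t 1) D2)).
  by rewrite /GRing.scale /= expr2; field.
have Fd'E (t : R) : 0 < t -> (derive1 Fd) t = - (d / t ^+ 2).
  by move=> t0; rewrite derive1E; have [_ ->] := dFd t t0.
have cFd' (t : R) : 0 < t -> {for t, continuous (derive1 Fd)}.
  move=> t0.
  have : {for t, continuous (fun s : R => - (d / s ^+ 2))}.
    apply: cvgN; apply: cvgM; first exact: cvg_cst.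
    by apply: cvgV; [rewrite expf_neq0// gt_eqF|exact: exprn_continuous].
  rewrite /prop_for /continuous_at Fd'E//; apply: cvg_trans.
  apply: near_eq_cvg; near=> s; rewrite Fd'E//.
  by near: s; exact: lt_nbhsr.
have cFd (t : R) : 0 < t -> {for t, continuous Fd}.
  move=> t0; apply/differentiable_continuous/derivable1_diffP.
  by have [] := dFd t t0.
have S1 : \int[leb]_(s in `[d, +oo[) Phi s = \int[leb]_(s in `[d, T]) Phi s.
  rewrite [LHS]Rintegral_mkcond [RHS]Rintegral_mkcond.
  apply: eq_Rintegral => s _; rewrite !patchE.
  have [sT|sT] := leP s T.
    congr (if _ then _ else _); apply/idP/idP; rewrite !inE /= !in_itv /= ?andbT.
      by move=> ->.
    by move=> /andP[].
  by rewrite sPhi//; do 2 case: ifP.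
have S2 : \int[leb]_(t in `]0, 1]) (Phi (d / t) * (d / t ^+ 2)) =
    \int[leb]_(t in `[a, 1]) (Phi (d / t) * (d / t ^+ 2)).
  rewrite [LHS]Rintegral_mkcond [RHS]Rintegral_mkcond.
  apply: eq_Rintegral => t _; rewrite !patchE.
  have [ta|ta] := leP a t.
    have t0 : 0 < t by exact: lt_le_trans ta.
    congr (if _ then _ else _); apply/idP/idP; rewrite !inE /= !in_itv /= ta ?t0//.
  rewrite [in RHS]memNset; last by rewrite /= in_itv /= leNgt ta.
  have [|//] := boolP (t \in `]0, 1]%classic).
  rewrite inE /= in_itv /= => /andP[t0 _]; rewrite sPhi ?mul0r//.
  by move: ta; rewrite /a ltr_pdivlMr// mulrC -ltr_pdivlMr.
rewrite S1 S2 -{1}Fd1 -{1}Fda /Rintegral; congr fine.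
rewrite integration_by_substitution_decreasing.
- apply: eq_integral => t; rewrite inE /= in_itv /= => /andP[ta _].
  have t0 : 0 < t by exact: lt_le_trans ta.
  by rewrite !fctE /= Fd'E// opprK.
- exact: ltW.
- move=> s t; rewrite !in_itv /= => /andP[sa _] /andP[ta _] st.
  rewrite /Fd ltr_pM2l// ltf_pV2// posrE; exact: lt_le_trans a0 _.
- move=> t; rewrite in_itv /= => /andP[ta _]; apply: cFd'.
  exact: lt_trans ta.
- by apply/cvg_ex; exists ((derive1 Fd) a); apply: cvg_at_right_filter; exact: cFd'.
- by apply/cvg_ex; exists ((derive1 Fd) 1); apply: cvg_at_left_filter; exact: cFd'.
- split.
  + move=> t; rewrite in_itv /= => /andP[ta _].
    by have [] := dFd t (lt_trans a0 ta).
  + by apply: cvg_at_right_filter; exact: cFd.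
  + by apply: cvg_at_left_filter; exact: cFd.
- exact: continuous_subspaceT.
Unshelve. all: by end_near. Qed.

End radial_substitution.

(** * Exchange of the integrals in [y] and [t] *)

Section kernel_fubini.
Context {R : realType} {n : nat}.
Notation rV := 'rV[R]_n.
Notation mu := (@rvmeas R n).
Notation leb := (@lebesgue_measure R).

(* Extending [t^-1] by [0] outside [`]0, 1]] makes it measurable on the whole line. *)
Definition qinv : R -> R := (@GRing.inv R) \_ `]0, 1]%classic.

Lemma qinv_in t : 0 < t <= 1 -> qinv t = t^-1.
Proof. by move=> t01; rewrite /qinv patchE mem_set//= in_itv. Qed.

Lemma qinv_out t : ~ 0 < t <= 1 -> qinv t = 0.
Proof. by move=> t01; rewrite /qinv patchE memNset//= in_itv. Qed.

Lemma measurable_qinv : measurable_fun [set: R] qinv.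
Proof.
have mI : measurable (`]0, 1]%classic : set R) by [].
apply/(measurable_restrictT _ mI).
by apply: measurable_inv_gt0 => //; exact: itvoc_gt0.
Qed.

Variables (E psi : rV -> R) (x : rV) (i : 'I_n) (L M Z C : R).
Hypotheses (L0 : 0 <= L) (dE : density L M E) (Z0 : 0 <= Z).
Hypotheses (bpsi : bump1 Z C psi).
Let M0 : 0 <= M := density_M_ge0 dE.
Let bp : bump_fun Z C psi. Proof. by have [] := bpsi. Qed.
Let C0 : 0 <= C := bump_C_ge0 bp.

(** The last factor is [0] when [t] is outside []0, 1]], so integrals of [Hk] over the whole line
    are integrals over []0, 1]], and Fubini applies on the full product space. *)
Definition Hk (p : rV * measurableTypeR R) : R :=
  E p.1 * ((x - p.1) 0 i * psi (p.1 + qinv p.2 *: (x - p.1))) * qinv p.2 ^+ n.+1.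

Lemma Hk_in y t : 0 < t <= 1 ->
  Hk (y, t) = t ^- n.+1 * (E y * ((x - y) 0 i * psi (pt t x y))).
Proof. by move=> t01; rewrite /Hk /= qinv_in// exprVn mulrC. Qed.

Lemma Hk_out y t : ~ 0 < t <= 1 -> Hk (y, t) = 0.
Proof. by move=> t01; rewrite /Hk /= qinv_out// expr0n mulr0. Qed.

Lemma measurable_Hk : measurable_fun setT Hk.
Proof.
have mq : measurable_fun setT (fun p : rV * measurableTypeR R => qinv p.2).
  exact: (measurableT_comp measurable_qinv measurable_snd).
have mc j : measurable_fun setT (fun p : rV * measurableTypeR R => (x - p.1) 0 j).
  exact: (measurableT_comp (measurable_coordB x j) measurable_fst).
have [mE _ _] := dE; have [cpsi _ _] := bp.
apply: measurable_funM; last exact: measurable_funX.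
apply: measurable_funM; first exact: (measurableT_comp mE measurable_fst).
apply: measurable_funM; first exact: mc.
have mr : measurable_fun setT
    (fun p : rV * measurableTypeR R => p.1 + qinv p.2 *: (x - p.1)).
  apply: measurable_rowP => j.
  apply: (eq_measurable_fun (fun p : rV * measurableTypeR R =>
      p.1 0 j + qinv p.2 * (x - p.1) 0 j)).
    by move=> p _; rewrite !mxE.
  apply: measurable_funD.
    exact: (measurableT_comp (coord_measurable j) measurable_fst).
  by apply: measurable_funM => //; exact: mc.
exact: (measurableT_comp (continuous_measurable_row cpsi) mr).
Qed.

Lemma measurable_Hk2 y :
  measurable_fun setT (fun t : measurableTypeR R => Hk (y, t)).
Proof. exact: (measurableT_comp measurable_Hk (measurable_pair1 y)). Qed.

Lemma integrable_Hk1 t : mu.-integrable setT (fun y => (Hk (y, t))%:E).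
Proof.
have [t01|t01] := pselect (0 < t <= 1); last first.
  by under eq_fun do rewrite Hk_out//; exact: integrable0.
under eq_fun do rewrite Hk_in// EFinM.
apply: integrableZl => //.
exact: (density_integrable (density_I1 L0 dE bp i t (lexx `|x|))).
Qed.

Lemma Rintegral_Hk1 t : 0 < t <= 1 -> \int[mu]_y Hk (y, t) = gk E psi i t x.
Proof.
move=> t01; under eq_Rintegral do rewrite Hk_in//.
rewrite RintegralZl//.
exact: (density_integrable (density_I1 L0 dE bp i t (lexx `|x|))).
Qed.

Lemma integrable_itv01 (K : R) :
  leb.-integrable setT (fun t => (K * \1_(`]0, 1]%classic : set R) t)%:E).
Proof.
under eq_fun do rewrite EFinM.
by apply: integrableZl => //; exact: integrable_indic_itv.
Qed.

(* Changing the sign of [E] pointwise turns the integral of [Hk] into the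
   integral of its absolute value, so that [gk_bound] applies. *)
Lemma integral_abs_Hk : exists2 B, 0 <= B &
  forall t, (\int[mu]_y `|(Hk (y, t))%:E| <= (B * \1_(`]0, 1]%classic : set R) t)%:E)%E.
Proof.
have [B B0 hB] := gk_bound L0 dE Z0 bpsi i (normr_ge0 x).
exists B => // t; have [t01|t01] := pselect (0 < t <= 1); last first.
  under eq_integral do rewrite Hk_out// abse0.
  by rewrite integral0 lee_fin mulr_ge0.
rewrite indicE mem_set ?mulr1; last by rewrite /= in_itv.
have /andP[t0 t1] := t01.
pose h (y : rV) := E y * ((x - y) 0 i * psi (pt t x y)).
pose Et (y : rV) := if 0 <= h y then E y else - E y.
have [mE bE sE] := dE.
have mh : measurable_fun setT h.
  by have [] := density_I1 L0 dE bp i t (lexx `|x|).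
have dEt : density L M Et.
  split.
  - apply: measurable_fun_ifT; [exact: measurable_fun_ler|exact: mE|exact: measurable_funN].
  - by move=> y; rewrite /Et; case: ifP; rewrite ?normrN bE.
  - by move=> y cy; rewrite /Et sE// oppr0; case: ifP.
have hE y : (`|(Hk (y, t))%:E| =
    (t ^- n.+1 * (Et y * ((x - y) 0 i * psi (pt t x y))))%:E)%E.
  rewrite Hk_in// -/(h y) /= normrM ger0_norm ?invr_ge0 ?exprn_ge0 ?(ltW t0)//.
  congr (_ * _)%:E; rewrite /Et; have [h0|h0] := leP 0 (h y).
    by rewrite ger0_norm.
  by rewrite ltr0_norm// mulNr.
have := hB _ dEt t x t01 (lexx _).
rewrite /gk /I1 -RintegralZl//; last first.
  exact: (density_integrable (density_I1 L0 dEt bp i t (lexx `|x|))).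
under eq_integral do rewrite hE.
move=> h1; rewrite -[X in (X <= _)%E]fineK; last first.
  apply: integrable_fin_num => //.
  under eq_fun do rewrite EFinM; apply: integrableZl => //.
  exact: (density_integrable (density_I1 L0 dEt bp i t (lexx `|x|))).
by rewrite lee_fin (le_trans (ler_norm _) h1).
Qed.

(** Integrating in [y] first is what makes Tonelli effective: [integral_abs_Hk] bounds the inner
    integral uniformly in [t], whereas in the other order the singular kernel would have to be
    estimated. *)
Lemma integrable_Hk :
  (mu \x leb)%E.-integrable setT (EFin \o Hk).
Proof.
have [B B0 hB] := integral_abs_Hk.
apply/integrable21ltyP; first by apply/measurable_EFinP; exact: measurable_Hk.
apply: (@le_lt_trans _ _ (\int[leb]_t (B * \1_(`]0%R, 1%R]%classic : set R) t)%:E)%E).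
  apply: ge0_le_integral => //=.
  - by move=> t _; apply: integral_ge0.
  - apply: (measurable_fun_fubini_tonelli_G (fun p => `|(Hk p)%:E|%E)) => //.
    by apply: measurableT_comp => //; apply/measurable_EFinP; exact: measurable_Hk.
  - by apply/measurable_EFinP; apply: measurable_funM => //; exact: measurable_indic.
  - by move=> t _; exact: hB.
have /integrableP[_] := integrable_itv01 B.
apply: le_lt_trans; apply: ge0_le_integral => //=.
- by move=> t _; rewrite lee_fin mulr_ge0.
- by apply/measurable_EFinP; apply: measurable_funM => //; exact: measurable_indic.
- apply/measurable_EFinP; apply: measurableT_comp => //.
  by apply: measurable_funM => //; exact: measurable_indic.
- by move=> t _; rewrite lee_fin ler_norm.
Qed.

(** For [t < a] the point [P_t(x, y)] is too far from the origin to meet the support of [psi], and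
    for [t >= a] the factor [t^-(n+1)] is at most [a^-(n+1)]. This holds for every [y], so
    [kernel_integrandE] is an identity everywhere. *)
Lemma integrable_Hk2 y : leb.-integrable setT (fun t => (Hk (y, t))%:E).
Proof.
have [_ bE _] := dE; have [_ bpb sp] := bp.
pose a := `|x - y| / (Z + `|y| + 1).
have c0 : 0 < Z + `|y| + 1 by rewrite ltr_wpDl// addr_ge0.
pose K := a ^- n.+1 * (M * (`|x - y| * C)).
have [xy|xy] := eqVneq x y.
  rewrite (_ : (fun t => _) = cst 0%E); first exact: integrable0.
  apply/funext => t; rewrite /Hk /= xy subrr mxE mul0r mulr0 mul0r //.
have a0 : 0 < a by rewrite divr_gt0// normr_gt0 subr_eq0.
apply: le_integrable (integrable_itv01 K) => //.
  by apply/measurable_EFinP; exact: measurable_Hk2.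
move=> t _; rewrite !abse_EFin lee_fin; have [t01|t01] := pselect (0 < t <= 1); last first.
  by rewrite Hk_out// normr0.
have /andP[t0 t1] := t01.
rewrite indicE mem_set ?mulr1; last by rewrite /= in_itv.
apply: le_trans (ler_norm _); rewrite Hk_in// !normrM.
have [ta|ta] := ltP t a.
  rewrite sp ?normr0 ?mulr0 ?mulr_ge0 ?invr_ge0 ?exprn_ge0//; first exact: ltW.
  have : `|t^-1 *: (x - y)| <= `|pt t x y| + `|y|.
    by rewrite -[X in `|X| <= _](addKr y) addrC ler_normB.
  rewrite normrZ gtr0_norm ?invr_gt0// => h2.
  have h1 : Z + `|y| + 1 < t^-1 * `|x - y|.
    by rewrite mulrC ltr_pdivlMr// mulrC -ltr_pdivlMr.
  have := lt_le_trans h1 h2; rewrite addrAC ltrD2r; apply: lt_trans.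
  by rewrite ltrDl.
rewrite /K ler_pM// ?ler_pM// ?row_coord_le//.
rewrite ger0_norm ?invr_ge0 ?exprn_ge0 ?(ltW t0)// lef_pV2 ?posrE ?exprn_gt0//.
by rewrite lerXn2r ?nnegrE ?(ltW a0) ?(ltW t0).
Qed.

Variables (Om : set rV) (F : rV -> R).
Hypotheses (n0 : (0 < n)%N) (EE : E = fun y => (y \in Om)%:R * F y).

(** With [d = |x - y|] in the Euclidean norm, the powers combine as
    [d^-n (d / t)^(n-1) d / t^2 = t^-(n+1)], and the argument of [psi] becomes [P_t(x, y)]. At
    [y = x] both sides vanish through the factor [(x - y)_i]. *)
Lemma kernel_integrandE y :
  kernel_integrand Om F psi x i y = \int[leb]_t Hk (y, t).
Proof.
have [cpsi bpb sp] := bp.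
have [xy|xy] := eqVneq x y.
  rewrite /kernel_integrand xy subrr mxE mul0r mul0r mulr0.
  under eq_Rintegral do rewrite /Hk /= xy subrr mxE mul0r mulr0 mul0r.
  by rewrite /Rintegral integral0.
have w0 : 0 < `|x - y| by rewrite normr_gt0 subr_eq0.
pose d := enorm (x - y).
have d0 : 0 < d by apply: lt_le_trans (norm_le_enorm _).
pose w := d^-1 *: (x - y).
have nw : 0 < `|w| by rewrite normrZ mulr_gt0// normr_gt0 invr_eq0 gt_eqF.
(* Beyond [(Z + |y|) / |w|] the ray from [y] has left the support of [psi]; adding [1 + d] also
   gives [d < T]. *)
pose T := (Z + `|y|) / `|w| + 1 + d.
have dT : d < T by rewrite ltrDr ltr_wpDl// divr_ge0// addr_ge0.
pose Phi (s : R) := psi (y + s *: w) * s ^+ n.-1.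
have cPhi : continuous Phi.
  move=> s; apply: cvgM; last exact: exprn_continuous.
  apply: (@cvg_comp _ _ _ (fun s : R => y + s *: w) psi _ (nbhs (y + s *: w))).
    apply: cvgD; first exact: cvg_cst.
    by apply: cvgZr_tmp; exact: cvg_id.
  exact: cpsi.
have sPhi s : T < s -> Phi s = 0.
  move=> Ts; rewrite /Phi sp ?mul0r//.
  have s0 : 0 < s by apply: lt_trans Ts; exact: lt_trans dT.
  have h1 : Z + `|y| < s * `|w|.
    rewrite -ltr_pdivrMr//; apply: lt_trans Ts.
    by rewrite /T -addrA ltrDl addr_gt0.
  have h2 : s * `|w| <= `|y + s *: w| + `|y|.
    rewrite (_ : s * `|w| = `|(y + s *: w) - y|); first exact: ler_normB.
    by rewrite addrC addKr (normrZ s w) (gtr0_norm s0).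
  by rewrite -(ltrD2r `|y|) (lt_le_trans h1).
have -> : kernel_integrand Om F psi x i y =
    E y * ((x - y) 0 i / d ^+ n * \int[leb]_(s in `[d, +oo[) Phi s) by rewrite EE.
rewrite (radial_substitution d0 dT cPhi sPhi).
have -> : \int[leb]_t Hk (y, t) = \int[leb]_(t in `]0, 1]) Hk (y, t).
  rewrite [RHS]Rintegral_mkcond; apply: eq_Rintegral => t _; rewrite patchE.
  case: ifPn => // t01; apply: Hk_out => t01'; move/negP: t01; apply.
  by rewrite inE /= in_itv.
have HE (t : R) : 0 < t <= 1 -> Hk (y, t) =
    (E y * ((x - y) 0 i / d ^+ n)) * (Phi (d / t) * (d / t ^+ 2)).
  move=> t01; have /andP[t0 _] := t01.
  rewrite Hk_in// /Phi (_ : (d / t) *: w = t^-1 *: (x - y)); last first.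
    by rewrite /w scalerA mulrAC divff ?mul1r// gt_eqF.
  have dn (u : R) : u ^+ n = u ^+ n.-1 * u by rewrite -exprSr prednK.
  rewrite -/(pt t x y) exprMn exprVn exprSr !dn expr2.
  by field; rewrite ?expf_neq0 ?(gt_eqF t0) ?(gt_eqF d0).
have -> : \int[leb]_(t in `]0, 1]) Hk (y, t) = \int[leb]_(t in `]0, 1])
    ((E y * ((x - y) 0 i / d ^+ n)) * (Phi (d / t) * (d / t ^+ 2))).
  by apply: eq_Rintegral => t; rewrite inE /= in_itv /=; exact: HE.
set c := E y * ((x - y) 0 i / d ^+ n).
(* The case [c = 0] is separate because integrability of the substituted integrand is obtained by
   dividing that of [Hk] by [c]. *)
rewrite mulrA -/c; have [c0|c0] := eqVneq c 0.
  rewrite c0 mul0r; under [RHS]eq_Rintegral do rewrite mul0r.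
  by rewrite /Rintegral integral0.
rewrite RintegralZl//.
have i1 : leb.-integrable `]0, 1]%classic (fun t => (Hk (y, t))%:E).
  by apply: integrableS (integrable_Hk2 y).
have i2 : leb.-integrable `]0, 1]%classic (fun t => c^-1%:E * (Hk (y, t))%:E)%E.
  exact: integrableZl.
apply: eq_integrable i2 => // t; rewrite inE /= in_itv /= => t01.
by rewrite (HE t t01) -EFinM mulKf.
Qed.

Lemma kernel_integrable :
  mu.-integrable setT (EFin \o kernel_integrand Om F psi x i).
Proof.
have := integrable_fubini_F integrable_Hk.
apply: eq_integrable => // y _; rewrite /fubini_F /= kernel_integrandE.
rewrite /Rintegral fineK//.
by apply: integrable_fin_num => //; exact: integrable_Hk2.
Qed.

Lemma Rn_integral_kernel : Rn_integral (kernel_integrand Om F psi x i) =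
  \int[leb]_(t in `]0, 1]) gk E psi i t x.
Proof.
rewrite Rn_integralE; last exact: kernel_integrable.
have -> : \int[mu]_y kernel_integrand Om F psi x i y =
    fine (\int[mu]_y \int[leb]_t (Hk (y, t))%:E)%E.
  rewrite /Rintegral; congr fine; apply: eq_integral => y _.
  rewrite kernel_integrandE /Rintegral fineK//.
  by apply: integrable_fin_num => //; exact: integrable_Hk2.
rewrite (Fubini integrable_Hk) [RHS]Rintegral_mkcond /Rintegral; congr fine.
apply: eq_integral => t _; rewrite patchE.
have [t01|t01] := boolP (t \in `]0, 1]%classic).
  have t01' : 0 < t <= 1 by move: t01; rewrite inE /= in_itv.
  rewrite -Rintegral_Hk1// /Rintegral fineK//.
  by apply: integrable_fin_num => //; exact: integrable_Hk1.
rewrite (eq_integral (cst 0%E)) ?integral0// => y _.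
rewrite /= Hk_out// => t01'; move/negP: t01; apply.
by rewrite inE /= in_itv.
Qed.

End kernel_fubini.

(** * Regularity and divergence of the field *)

Section row_valued.
Context {R : realType} {n : nat}.
Notation rV := 'rV[R]_n.

Lemma cvg_row (T : topologicalType) (v : T -> rV) (a : T) (l : rV) :
  (forall i, (fun x => v x 0 i) @ nbhs a --> l 0 i) -> v @ nbhs a --> l.
Proof.
move=> cv; apply/cvgrPdist_lt => e e0.
have : \forall x \near a, forall i, `|l 0 i - v x 0 i| < e / 2.
  apply: filter_forall => i; move: (cv i) => /cvgrPdist_lt; apply.
  exact: divr_gt0.
apply: filterS => x h; apply: (@le_lt_trans _ _ (e / 2)); last first.
  by rewrite ltr_pdivrMr// ltr_pMr// ltr1n.
by apply: row_norm_le => [|i]; rewrite ?divr_ge0 ?ltW// !mxE; exact: h.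
Qed.

Lemma near_dist_lt (a : rV) (e : R) : 0 < e -> \forall x \near a, `|a - x| < e.
Proof. by move=> e0; apply/nbhs_ballP; exists e => // x; rewrite -ball_normE. Qed.

Lemma is_derive_row (v : rV -> rV) (a w d : rV) :
  (forall i, is_derive a w (fun x => v x 0 i) (d 0 i)) -> is_derive a w v d.
Proof.
move=> dv.
have D : derivable v a w by apply/derivable_mxP => k i; rewrite (ord1 k); have [] := dv i.
apply: DeriveDef => //; rewrite derive_mx//.
by apply/rowP => i; rewrite mxE; have [_ ->] := dv i.
Qed.

Lemma cvg_fst_section (f : R -> rV -> R) (t : R) (x : rV) (l : R) :
  (fun p : R * rV => f p.1 p.2) @ nbhs (t, x) --> l ->
  (fun s => f s x) @ nbhs t --> l.
Proof.
have h1 : (fun s : R => (s, x)) @ nbhs t --> (t, x).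
  by apply: (@cvg_pair _ _ _ (nbhs t) (nbhs t) (nbhs x)); [exact: cvg_id|exact: cvg_cst].
by move=> h; exact: (cvg_comp _ _ h1 h).
Qed.

Lemma cvg_snd_section (f : R -> rV -> R) (t : R) (x : rV) (l : R) :
  (fun p : R * rV => f p.1 p.2) @ nbhs (t, x) --> l ->
  (fun z => f t z) @ nbhs x --> l.
Proof.
have h1 : (fun z : rV => (t, z)) @ nbhs x --> (t, x).
  by apply: (@cvg_pair _ _ _ (nbhs x) (nbhs t) (nbhs x)); [exact: cvg_cst|exact: cvg_id].
by move=> h; exact: (cvg_comp _ _ h1 h).
Qed.

End row_valued.

Section integrals_on_itv01.
Context {R : realType}.
Notation leb := (@lebesgue_measure R).

Lemma measurable_itv01 (f : R -> R) :
  (forall t : R, 0 < t -> f @ nbhs t --> f t) -> measurable_fun (`]0, 1]%classic : set R) f.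
Proof.
move=> cf.
have mf : measurable_fun (`]0, +oo[%classic : set R) f.
  apply: open_continuous_measurable_fun; first exact: interval_open.
  by move=> t; rewrite inE /= in_itv /= andbT; exact: cf.
by apply: measurable_funS mf => //; exact: itvoc_gt0.
Qed.

Lemma bounded_integrable_itv01 (f : R -> R) (B : R) :
  measurable_fun (`]0, 1]%classic : set R) f -> (forall t : R, 0 < t <= 1 -> `|f t| <= B) ->
  leb.-integrable `]0, 1]%classic (EFin \o f).
Proof.
move=> mf fB.
have iB : leb.-integrable `]0, 1]%classic
    (fun t => (B * \1_(`]0, 1]%classic : set R) t)%:E).
  by apply: integrableS (integrable_itv01 B).
apply: le_integrable iB => //; first exact/measurable_EFinP.
move=> t /= t01; rewrite lee_fin indicE mem_set// mulr1.
by apply: le_trans (ler_norm _); apply: fB; move: t01; rewrite in_itv.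
Qed.

End integrals_on_itv01.

(** * Differentiation of the field under the integral in [t], given a dominating function *)

Section field.
Context {R : realType} {n : nat}.
Notation rV := 'rV[R]_n.
Notation leb := (@lebesgue_measure R).
Notation mu := (@rvmeas R n).

Definition field_coord (E psi : rV -> R) i x :=
  \int[leb]_(t in `]0, 1]) gk E psi i t x.
Definition dfield_coord (E psi : rV -> R) i j x :=
  \int[leb]_(t in `]0, 1]) dgk E psi i j t x.

Variables (L M Z C : R) (E psi : rV -> R).
Hypotheses (L0 : 0 <= L) (dE : density L M E) (Z0 : 0 <= Z).
Hypotheses (bpsi : bump1 Z C psi) (psi1 : \int[mu]_z psi z = 1).

Lemma measurable_gk i x : measurable_fun (`]0, 1]%classic : set R) (gk E psi i ^~ x).
Proof.
apply: measurable_itv01 => t t0; apply: (cvg_fst_section (f := gk E psi i)).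
by apply: (cvg_gk L0 dE bpsi); rewrite gt_eqF.
Qed.

Lemma measurable_dgk i j x : measurable_fun (`]0, 1]%classic : set R) (dgk E psi i j ^~ x).
Proof.
apply: measurable_itv01 => t t0; apply: (cvg_fst_section (f := dgk E psi i j)).
by apply: (cvg_dgk L0 dE bpsi); rewrite gt_eqF.
Qed.

Lemma integrable_gk i x : leb.-integrable `]0, 1]%classic (EFin \o gk E psi i ^~ x).
Proof.
have [B _ hB] := gk_bound L0 dE Z0 bpsi i (normr_ge0 x).
apply: (@bounded_integrable_itv01 _ _ B); first exact: measurable_gk.
by move=> t t01; exact: hB.
Qed.

Lemma continuous_field_coord i : continuous (field_coord E psi i).
Proof.
move=> x.
have r0 : 0 <= `|x| + 1 by rewrite addr_ge0.
have [B B0 hB] := gk_bound L0 dE Z0 bpsi i r0.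
apply: (@cvg_Rintegral_dominated R _ _ leb _ _ rV x (fun z t => gk E psi i t z)
  (fun=> B)) => //.
- apply: (@bounded_integrable_itv01 _ _ B) => // t _.
  by rewrite ger0_norm.
- apply: filterS (near_dist_lt x ltr01) => z xz.
  have zx : `|z| <= `|x| + 1.
    rewrite -(subrK x z) addrC (le_trans (ler_normD _ _))// lerD2l distrC.
    exact: ltW.
  split; first exact: integrable_gk.
  by move=> t /=; rewrite in_itv /= => t01; exact: hB.
- move=> t /=; rewrite in_itv /= => /andP[t0 _].
  apply: (cvg_snd_section (f := gk E psi i)).
  by apply: (cvg_gk L0 dE bpsi); rewrite gt_eqF.
Qed.

Section near_point.
Variables (i j : 'I_n) (a : rV) (e : R) (G : R -> R).
Hypotheses (e0 : 0 < e) (iG : leb.-integrable `]0, 1]%classic (EFin \o G)).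
Hypothesis domG : forall (x : rV) (t : R), `|x - a| < e -> 0 < t <= 1 ->
  `|dgk E psi i j t x| <= G t.

Lemma integrable_dgk x : `|x - a| < e ->
  leb.-integrable `]0, 1]%classic (EFin \o dgk E psi i j ^~ x).
Proof.
move=> xa; apply: le_integrable iG => //.
  by apply/measurable_EFinP; exact: measurable_dgk.
move=> t /=; rewrite in_itv /= => t01; rewrite lee_fin.
by rewrite (le_trans (domG xa t01))// ler_norm.
Qed.

Lemma is_derive_field_coord :
  is_derive a (ebase R j) (field_coord E psi i) (dfield_coord E psi i j a).
Proof.
apply: is_derive_line0.
pose xh (h : R) := a + h *: ebase R j.
have xha (h : R) : `|h - 0| < e -> `|xh h - a| < e.
  by rewrite subr0 /xh addrAC subrr add0r normrZ norm_ebase mulr1.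
have H := @is_derive_Rintegral _ _ _ leb `]0, 1]%classic (measurable_itv _)
  (fun h t => gk E psi i t (xh h)) (fun h t => dgk E psi i j t (xh h)) G 0 e e0
  (fun h _ => integrable_gk i (xh h)) _ iG _.
apply: (is_derive_eq (H _ _)).
- move=> h t _ _.
  have [dg vg] := is_derive_gk L0 dE bpsi i j t (xh h).
  by apply: (is_derive_eq (is_derive_line dg)).
- move=> h t ha /=; rewrite in_itv /= => t01; apply: domG => //; exact: xha.
- by rewrite /xh scale0r addr0.
Qed.

Lemma cvg_dfield_coord :
  dfield_coord E psi i j @ nbhs a --> dfield_coord E psi i j a.
Proof.
apply: (@cvg_Rintegral_dominated R _ _ leb _ _ rV a (fun z t => dgk E psi i j t z)
  G) => //.
- apply: filterS (near_dist_lt a e0) => z; rewrite distrC => za.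
  split; first exact: integrable_dgk.
  by move=> t /=; rewrite in_itv /= => t01; exact: domG.
- move=> t /=; rewrite in_itv /= => /andP[t0 _].
  apply: (cvg_snd_section (f := dgk E psi i j)).
  by apply: (cvg_dgk L0 dE bpsi); rewrite gt_eqF.
Qed.

End near_point.

End field.

(** * Domination at interior points and computation of the divergence *)

Section interior_estimates.
Context {R : realType} {n : nat}.
Notation rV := 'rV[R]_n.
Notation leb := (@lebesgue_measure R).
Notation mu := (@rvmeas R n).
Variables (Om : set rV) (F psi : rV -> R) (p0 : rV) (dl L M Z C : R).
Let E (y : rV) : R := (y \in Om)%:R * F y.
Hypotheses (oOm : open Om) (Op0 : Om p0) (dl0 : 0 < dl).
Hypothesis dini : (\int[leb]_(rho in (`]0%R, dl]%classic : set R))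
   (modcont Om F rho * (rho^-1)%:E) < +oo)%E.
Hypotheses (L0 : 0 <= L) (dE : density L M E) (Z0 : 0 <= Z).
Hypotheses (bpsi : bump1 Z C psi) (psi1 : \int[mu]_z psi z = 1).
Let w (t : R) : R := fine (modcont Om F t).

Let w_ge0 (t : R) : 0 < t -> 0 <= w t.
Proof. by move=> t0; apply: fine_ge0; exact: (modcont_ge0 F Op0 t0). Qed.

Lemma interior_bounds a : Om a -> exists e t2 W : R,
  [/\ 0 < e, 0 < t2 <= 1 / 2, 0 <= W,
      leb.-integrable `]0, t2]%classic (EFin \o (fun t => w t / t)) &
      forall (x : rV) (t : R), `|x - a| < e -> 0 < t <= t2 ->
        (forall i j, `|dgk E psi i j t x| <= W * (w t / t) + M * 2 ^+ n.+1) /\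
        `|Ak E psi t x - E x * (1 - t)^-1 ^+ n| <= W * w t].
Proof.
move=> Oa; have [rho0 [/andP[r0 rd] hw iw]] := modcont_real Op0 dl0 dini.
pose r := `|a| + 1.
have rr : 0 <= r by rewrite addr_ge0.
have c0 : 0 <= 2 * (Z + r) by rewrite mulr_ge0// addr_ge0.
have [N [e [t1 [e0 /andP[t10 t1r] hN]]]] := dini_local oOm r0 c0 hw Oa.
have [W W0 hW] := near_zero L0 dE Z0 bpsi psi1 rr.
(* The radius is at most [1] so that [|x| <= |a| + 1 = r], and [t2] at most [1/2] as [near_zero]
   requires; [N] comes from chaining with [c = 2 (Z + r)]. *)
exists (Num.min e 1), (Num.min t1 (1 / 2)), (W * N%:R).
have t2r : Num.min t1 (1 / 2) <= rho0 by rewrite ge_min t1r.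
split.
- by rewrite lt_min e0 ltr01.
- by rewrite lt_min t10 ge_min lexx orbT divr_gt0.
- by rewrite mulr_ge0.
- by apply: integrableS iw => //; apply: subset_itvl; rewrite bnd_simp.
move=> x t; rewrite lt_min => /andP[xe x1] /andP[t0]; rewrite le_min => /andP[tt1 t2].
have xr : `|x| <= r.
  rewrite -(subrK a x) addrC (le_trans (ler_normD _ _))// lerD2l.
  exact: ltW.
have t02 : 0 < t <= 1 / 2 by rewrite t0.
have eta0 : 0 <= N%:R * w t by rewrite mulr_ge0// w_ge0.
have [|h1 h2] := hW t x (N%:R * w t) t02 xr eta0.
  move=> y yx; apply: hN => //; first by rewrite t0.
  by rewrite mulrCA mulrA.
split; last by rewrite -(mulrA W); exact: h2.
move=> i j; rewrite (_ : W * N%:R * (w t / t) = W * (N%:R * w t / t)); last by ring.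
exact: h1.
Qed.

(** [G] adds three contributions: the Dini quotient cut off at [t2], the constant left by the
    cancellation, and the crude bound [B] valid for [t >= t2]. *)
Lemma interior_domination i j a : Om a -> exists e (G : R -> R),
  [/\ 0 < e, leb.-integrable `]0, 1]%classic (EFin \o G) &
      forall (x : rV) (t : R), `|x - a| < e -> 0 < t <= 1 -> `|dgk E psi i j t x| <= G t].
Proof.
move=> Oa; have [e [t2 [W [e0 /andP[t20 t2h] W0 iw hW]]]] := interior_bounds Oa.
have r0 : 0 <= `|a| + e by rewrite addr_ge0// ltW.
have [B hB] := dgk_bound L0 dE bpsi i j r0 t20.
have M0 := density_M_ge0 dE.
pose q : R -> R := (fun t => w t / t) \_ `]0, t2]%classic.
have q0 t : 0 <= q t.
  rewrite /q patchE; case: ifPn => //; rewrite inE /= in_itv /= => /andP[t0 _].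
  by rewrite divr_ge0 ?w_ge0// ltW.
have iq : leb.-integrable `]0, 1]%classic (EFin \o q).
  have : leb.-integrable setT ((EFin \o (fun t => w t / t)) \_ `]0, t2]%classic).
    by apply/(integrable_mkcond _ _).1.
  rewrite -restrict_EFin => h.
  by apply: integrableS h.
exists e, (fun t => W * q t + (M * 2 ^+ n.+1 + `|B|)); split => //.
  have i1 : leb.-integrable `]0, 1]%classic (fun t => W%:E * (q t)%:E)%E.
    exact: integrableZl.
  have i2 : leb.-integrable `]0, 1]%classic (EFin \o (fun=> M * 2 ^+ n.+1 + `|B|)).
    by apply: (@bounded_integrable_itv01 _ _ `|M * 2 ^+ n.+1 + `|B| |).
  exact: (integrableD _ i1 i2).
move=> x t xa /andP[t0 t1]; have [tt2|tt2] := leP t t2.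
  have t02 : 0 < t <= t2 by rewrite t0.
  have [h _] := hW x t xa t02.
  apply: (le_trans (h i j)); rewrite /q patchE mem_set; last by rewrite /= in_itv.
  by rewrite lerD2l lerDl.
apply: (@le_trans _ _ B).
  apply: hB; first exact: ltW.
  rewrite -(subrK a x) addrC (le_trans (ler_normD _ _))// lerD2l.
  exact: ltW.
rewrite (le_trans (ler_norm _))// addrA lerDr addr_ge0 ?mulr_ge0//.
Qed.

(** Up to [W w(t)], [A(t)] is [E(a) (1 - t)^-n]. The first term is small by [modcont_small], and the
    second tends to [E(a)]; each receives half of [e]. *)
Lemma Ak_cvg0 a (e : R) : Om a -> 0 < e -> exists2 t0, 0 < t0 &
  forall t, 0 < t <= t0 -> `|Ak E psi t a - E a| < e.
Proof.
move=> Oa e0; have [d [t2 [W [d0 /andP[t20 t2h] W0 _ hW]]]] := interior_bounds Oa.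
have aa : `|a - a| < d by rewrite subrr normr0.
have eW : 0 < e / 2 / (W + 1) by rewrite !divr_gt0// ltr_wpDl.
have [rho /andP[r0 rd] mr] := modcont_small dl0 dini eW.
have c1 : (fun t : R => E a * (1 - t)^-1 ^+ n) @ nbhs (0 : R) --> E a * (1 - 0)^-1 ^+ n.
  apply: cvgM; first exact: cvg_cst.
  apply: (@cvg_comp _ _ _ (fun t : R => (1 - t)^-1) (fun s : R => s ^+ n) _
    (nbhs ((1 - 0 : R)^-1))); last exact: exprn_continuous.
  apply: cvgV; first by rewrite subr0 oner_eq0.
  by apply: cvgB; [exact: cvg_cst|exact: cvg_id].
have e20 : 0 < e / 2 by rewrite divr_gt0.
move/cvgrPdist_lt : c1 => /(_ _ e20)/nbhs_ballP[t3 /= t30 h3].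
exists (Num.min (Num.min rho t2) (t3 / 2)).
  by rewrite !lt_min r0 t20 divr_gt0.
move=> t /andP[t0]; rewrite !le_min => /andP[/andP[tr tt2] tt3].
have t02 : 0 < t <= t2 by rewrite t0.
have [_ h] := hW a t aa t02.
have wt : W * w t <= e / 2.
  have wle : w t <= e / 2 / (W + 1).
    rewrite -lee_fin; apply: le_trans (ltW mr).
    apply: le_trans (le_modcont Om F tr).
    rewrite /w fineK//; rewrite ge0_fin_numE; last exact: (modcont_ge0 F Op0 t0).
    by apply: le_lt_trans (le_modcont _ _ tr) _; rewrite (lt_trans mr)// ltry.
  apply: (@le_trans _ _ ((W + 1) * (e / 2 / (W + 1)))).
    by rewrite ler_pM ?w_ge0// lerDl.
  by rewrite mulrC divfK// gt_eqF// ltr_wpDl.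
have h4 : `|E a - E a * (1 - t)^-1 ^+ n| < e / 2.
  have := h3 t; rewrite subr0 invr1 expr1n mulr1; apply.
  rewrite /ball /= sub0r normrN gtr0_norm// (le_lt_trans tt3)//.
  by rewrite ltr_pdivrMr// ltr_pMr// ltr1n.
rewrite (_ : Ak E psi t a - E a = (Ak E psi t a - E a * (1 - t)^-1 ^+ n)
   - (E a - E a * (1 - t)^-1 ^+ n)); last by ring.
rewrite (splitr e) (le_lt_trans (ler_normB _ _))// ler_ltD//.
exact: le_trans wt.
Qed.

Hypothesis E0 : \int[mu]_y E y = 0.

(** [- A] is a primitive of the diagonal sum, and [A(1) = 0] because [E] has integral zero. Only
    [[b, 1]] is used, since [A] need not be differentiable at [0]. *)
Lemma integral_dgk_tail a (b : R) : 0 < b < 1 ->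
  \int[leb]_(t in `[b, 1]) (\sum_(i < n) dgk E psi i i t a) = Ak E psi b a.
Proof.
move=> /andP[b0 b1].
have cS (t : R) : 0 < t ->
    (fun t => \sum_(i < n) dgk E psi i i t a) @ nbhs t --> \sum_(i < n) dgk E psi i i t a.
  move=> t0; apply: cvg_big => [|i _]; first exact: add_continuous.
  apply: (cvg_fst_section (f := dgk E psi i i)).
  by apply: (cvg_dgk L0 dE bpsi); rewrite gt_eqF.
have dA (t : R) : 0 < t -> is_derive t 1 (fun t => - Ak E psi t a)
    (\sum_(i < n) dgk E psi i i t a).
  move=> t0; have D := is_derive_Ak L0 dE bpsi a t0.
  by apply: (is_derive_eq (is_deriveN D)); rewrite opprK.
have cA (t : R) : 0 < t -> {for t, continuous (fun t : R => - Ak E psi t a)}.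
  move=> t0; apply/differentiable_continuous/derivable1_diffP.
  by have [] := dA t t0.
rewrite /Rintegral (@continuous_FTC2 _ _ (fun t => - Ak E psi t a) b 1)//.
- by rewrite /= (Ak1 psi dE) E0 mulr0 oppr0 sub0r opprK.
- apply: continuous_in_subspaceT => t; rewrite inE /= in_itv /= => /andP[bt _].
  by apply: cS; exact: lt_le_trans bt.
- split.
  + move=> t; rewrite in_itv /= => /andP[bt _].
    by have [] := dA t (lt_trans b0 bt).
  + by apply: cvg_at_right_filter; exact: cA.
  + by apply: cvg_at_left_filter; exact: cA.
- move=> t; rewrite in_itv /= => /andP[bt _].
  by rewrite derive1E; have [_ ->] := dA t (lt_trans b0 bt).
Qed.

(** Cutting the integral at a small [b] leaves [A(b)], close to [E(a)], plus an integral over []0,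
    b]], which is small because domination makes the diagonal sum integrable. *)
Lemma sum_dfield_coord a : Om a -> \sum_(i < n) dfield_coord E psi i i a = E a.
Proof.
move=> Oa; pose S (t : R) := \sum_(i < n) dgk E psi i i t a.
have iD i : leb.-integrable `]0, 1]%classic (EFin \o (dgk E psi i i ^~ a)).
  have [e [G [e0 iG dG]]] := interior_domination i i Oa.
  by apply: (integrable_dgk L0 dE bpsi iG dG); rewrite subrr normr0.
have iS : leb.-integrable `]0, 1]%classic (EFin \o S).
  exact: (integrable_Rsum _ iD).
have -> : \sum_(i < n) dfield_coord E psi i i a = \int[leb]_(t in `]0, 1]) S t.
  by rewrite /S Rintegral_sum.
apply/eqP; rewrite -subr_eq0 -normr_le0; apply/ler_addgt0Pr => e e0.
have e20 : 0 < e / 2 by rewrite divr_gt0.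
have [b1 /andP[b10 b11] hb1] := Rintegral_near0 ltr01 e20 iS.
have [b2 b20 hb2] := Ak_cvg0 Oa e20.
pose b := Num.min (Num.min b1 b2) (1 / 2).
have b0 : 0 < b by rewrite !lt_min b10 b20 divr_gt0.
have bb1 : b <= b1 by rewrite !ge_min lexx.
have bb2 : b <= b2 by rewrite !ge_min lexx orbT.
have bl1 : b < 1 by apply: (@le_lt_trans _ _ (1 / 2)); [rewrite ge_min lexx orbT|lra].
have -> : \int[leb]_(t in `]0, 1]) S t =
    \int[leb]_(t in `]0, b]) S t + Ak E psi b a.
  rewrite -(@integral_dgk_tail a b) ?b0//.
  have := @Rintegral_itvB _ S (BRight 0) (BRight 1) b iS; rewrite !bnd_simp.
  rewrite (ltW b0) (ltW bl1) => /(_ isT isT).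
  rewrite (@Rintegral_itv_obnd_cbnd _ b (BRight 1) S); last first.
    apply: integrableS iS => //; apply: subset_itvr; rewrite bnd_simp.
    exact: ltW.
  by move=> <-; rewrite addrC subrK.
rewrite add0r -addrA (le_trans (ler_normD _ _))// (splitr e) lerD//.
  by apply: ltW; apply: hb1; rewrite b0.
by apply: ltW; apply: hb2; rewrite b0.
Qed.

End interior_estimates.

Section bogovskii_field.
Context {R : realType} {n : nat}.
Notation rV := 'rV[R]_n.

Lemma kernel_integrand_outside (Om : set rV) (F psi : rV -> R) (x : rV) (i : 'I_n) (y : rV) :
  (forall z, psi z != 0 -> star_shaped Om z) -> ~ Om x ->
  kernel_integrand Om F psi x i y = 0.
Proof.
move=> star nOx; rewrite /kernel_integrand.
have [Oy|] := boolP (y \in Om); last by rewrite !mul0r.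
rewrite inE in Oy; set d := enorm (x - y).
have d0 : 0 < d.
  apply: lt_le_trans (norm_le_enorm _); rewrite normr_gt0 subr_eq0.
  by apply/eqP => xy; apply: nOx; rewrite xy.
under eq_Rintegral => s.
  rewrite inE /= in_itv /= andbT => ds.
  have s0 : 0 < s by exact: lt_le_trans ds.
  rewrite (_ : psi _ = 0); last first.
    (* Writing [z] for the argument of [psi], [x = (d / s) z + (1 - d / s) y] with [d <= s]. If
       [psi z] were nonzero, [Om] would be star-shaped with respect to [z] and would contain [x]. *)
    apply/eqP; apply: contrapT => /negP /star[_ /(_ y Oy (1 - d / s))] h.
    apply: nOx; rewrite (_ : x = (1 - (1 - d / s)) *: (y + s *: (d^-1 *: (x - y)))
      + (1 - d / s) *: y).
      apply: h; rewrite subr_ge0 ler_pdivrMr// mul1r ds /= lerBlDr lerDl.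
      by rewrite divr_ge0 ?ltW.
    rewrite subKr scalerDr addrAC -scalerDl subrKC scale1r !scalerA.
    rewrite (_ : d / s * s / d = 1); first by rewrite scale1r subrKC.
    by field; rewrite !gt_eqF.
  rewrite mul0r; over.
by rewrite /Rintegral integral0 !mulr0.
Qed.

Lemma Rn_integral0 : Rn_integral (fun _ : rV => 0 : R) = 0.
Proof.
rewrite Rn_integralE /Rintegral ?integral0//.
exact: (integrable0 (@rvmeas R n) setT).
Qed.

End bogovskii_field.

(** The integrability clause ensures that [Rn_integral], a difference of two [fine] values, is a
    genuine integral in the formula for the field. *)
Theorem theorem14 (R : realType) (n : nat) (x0 : 'rV[R]_n) (r : R)
    (psi : 'rV[R]_n -> R) (Om : set 'rV[R]_n) (F : 'rV[R]_n -> R) :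
  (2 <= n)%N -> 0 < r ->
  C0inf psi -> fsupp psi `<=` eball x0 r ->
  Rn_integral psi = 1 ->
  open Om -> ebounded Om ->
  (forall p, closure (eball x0 r) p -> star_shaped Om p) ->
  C_D Om F ->
  Rn_integral (fun y => (y \in Om)%:R * F y) = 0 ->
  (forall x (i : 'I_n), Rn_integrable (kernel_integrand Om F psi x i)) /\
  continuous (bogovskii Om F psi) /\
  C1_on Om (bogovskii Om F psi) /\
  (forall x, Om x -> divergence (bogovskii Om F psi) x = F x) /\
  (forall x, ~ Om x -> bogovskii Om F psi x = 0).
Proof.
move=> n2 r0 spsi supp psi1 oOm bOm star [dl [dl0 dini]] E0.
have n0 : (0 < n)%N by exact: leq_trans n2.
have Cx0 : closure (eball x0 r) x0.
  apply: subset_closure; rewrite /eball /= subrr /enorm.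
  by rewrite big1 ?sqrtr0// => i _; rewrite mxE expr0n.
have starx0 := star _ Cx0; have [Ox0 _] := starx0.
have [L [M [L0 dE]]] := density_extension Ox0 dl0 dini oOm bOm starx0.
have [Z [C [Z0 bpsi]]] := bump1_of_C0inf r0 spsi supp.
pose E (y : 'rV[R]_n) := (y \in Om)%:R * F y.
have iE : density L M E by exact: dE.
have bp : bump_fun Z C psi by have [] := bpsi.
have {}psi1 : \int[rvmeas n]_z psi z = 1.
  by rewrite -Rn_integralE//; exact: bump_integrable bp.
have {}E0 : \int[rvmeas n]_y E y = 0.
  by rewrite -Rn_integralE//; exact: density_integrable dE.
have vE x i : bogovskii Om F psi x 0 i = field_coord E psi i x.
  by rewrite mxE (Rn_integral_kernel x i L0 dE Z0 bpsi n0 erefl).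
have vEf i : (fun x => bogovskii Om F psi x 0 i) = field_coord E psi i.
  by apply/funext => x; exact: vE.
have dom i j a (Oa : Om a) :=
  interior_domination oOm Ox0 dl0 dini L0 dE Z0 bpsi psi1 i j Oa.
have dv j a : Om a -> is_derive a (ebase R j) (bogovskii Om F psi)
    (\row_i dfield_coord E psi i j a).
  move=> Oa; apply: is_derive_row => i; rewrite mxE.
  have [e [G [e0 iG dG]]] := dom i j a Oa.
  rewrite vEf; exact: (is_derive_field_coord L0 dE Z0 bpsi e0 iG dG).
split=> [x i|].
  have ik := kernel_integrable x i L0 dE Z0 bpsi n0 erefl.
  apply/Rn_integrableE => //.
  by apply/measurable_EFinP; exact: measurable_int ik.
split=> [x|].
  apply: (@cvg_row _ _ _ _ x (bogovskii Om F psi x)) => i.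
  have := @continuous_field_coord _ _ _ _ _ _ _ _ L0 dE Z0 bpsi i x.
  by rewrite -vEf.
split=> [j x Ox|].
  split; first by have [] := dv j x Ox.
  have dvE z : Om z -> 'D_(ebase R j) (bogovskii Om F psi) z = \row_i dfield_coord E psi i j z.
    by move=> Oz; have [_ ->] := dv j z Oz.
  rewrite /prop_for /continuous_at dvE//.
  (* The derivative is known to be this row only on [Om]; [Om] being a neighbourhood of [x],
     continuity carries over to the derivative. *)
  have c : (fun z => \row_i dfield_coord E psi i j z) @ nbhs x -->
      (\row_i dfield_coord E psi i j x).
    apply: (@cvg_row _ _ _ _ x (\row_i dfield_coord E psi i j x)) => i.
    have [e [G [e0 iG dG]]] := dom i j x Ox.
    have := cvg_dfield_coord L0 dE bpsi e0 iG dG.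
    suff <- : (fun z => (\row_k dfield_coord E psi k j z) 0 i) = dfield_coord E psi i j by [].
    by apply/funext => z; rewrite mxE.
  have nO : nbhs x Om by exact: open_nbhs_nbhs.
  apply: (cvg_trans (@near_eq_cvg _ _ (nbhs x) _ _ _ _) c).
  by apply: (filterS _ nO) => z Oz; rewrite dvE.
split=> [x Ox|x nOx].
  have dEx := sum_dfield_coord oOm Ox0 dl0 dini L0 dE Z0 bpsi psi1 E0 Ox.
  rewrite mem_set// mul1r in dEx; rewrite -dEx; apply: eq_bigr => i _.
  by have [_ ->] := dv i x Ox; rewrite mxE.
apply/rowP => i; rewrite !mxE (_ : kernel_integrand _ _ _ _ _ = fun=> 0).
  exact: Rn_integral0.
apply/funext => y; apply: kernel_integrand_outside => // z psiz.
by apply: star; apply: subset_closure; apply: supp; apply: subset_closure.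
Qed.
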